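(* Let $X$ be a compact metrizable space, $T:X\to X$ a continuous map, and $d$ a compatible metric on $X$ such that $\overline{\mathrm{mdim}}_M(T,X,d)<\infty$. Then for all $f\in C(X,\mathbb{R})$, $$\overline{\mathrm{mdim}}_M(T,f,d)=\max_{\mu\in M(X,T)}\Big\{F(\mu,d)+\int f\,d\mu\Big\},$$ where $\overline{\mathrm{mdim}}_M(T,f,d)$ is the upper metric mean dimension with potential $f$ and $F(\mu,d)$ is the upper measure-theoretical metric mean dimension of $\mu$.
   Context: $X$ is a (nonempty) compact metrizable space, $T:X\to X$ is continuous, $d$ is a compatible metric. $M(X)$ is the set of Borel probability measures on $X$; $M(X,T)\subset M(X)$ is the set of $T$-invariant ones. $C(X,\mathbb{R})$ is the space of continuous real-valued functions on $X$ with the supremum norm. For $f\in C(X,\mathbb{R})$ and $n\ge 1$ put $S_nf(x)=\sum_{j=0}^{n-1}f(T^jx)$ and $d_n(x,y)=\max_{0\le j\le n-1}d(T^jx,T^jy)$. For $0<\epsilon<1$ set $$R_n(X,f,d,\epsilon)=\inf\Big\{\sum_{i=1}^{k}(1/\epsilon)^{\sup_{x\in U_i}S_nf(x)}: X=U_1\cup\dots\cup U_k,\ \mathrm{diam}(U_i,d_n)<\epsilon\ \text{for all } i=1,\dots,k\Big\}$$ (the infimum is over all finite covers of $X$ by nonempty sets, with $k$ arbitrary), and $R(X,f,d,\epsilon)=\lim_{n\to\infty}\frac1n\log R_n(X,f,d,\epsilon)$; the limit exists by subadditivity. The upper metric mean dimension of $X$ with potential $f$ is $$\overline{\mathrm{mdim}}_M(T,f,d)=\overline{\mathrm{mdim}}_M(T,X,f,d)=\limsup_{\epsilon\to0}\frac{R(X,f,d,\epsilon)}{\log\frac1\epsilon},$$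 and $\overline{\mathrm{mdim}}_M(T,X,d)=\overline{\mathrm{mdim}}_M(T,X,0,d)$ (zero potential). Assuming $\overline{\mathrm{mdim}}_M(T,X,d)<\infty$, for $\mu\in M(X)$ the upper measure-theoretical metric mean dimension of $\mu$ is $$F(\mu,d)=\inf_{g\in\mathcal{A}}\int g\,d\mu,\qquad \mathcal{A}=\{g\in C(X,\mathbb{R}):\overline{\mathrm{mdim}}_M(T,-g,d)=0\}$$ (with values in $[-\infty,\infty)$). *)

(* Defs.v *)
From HB Require Import structures.
From mathcomp Require Import all_boot all_order all_algebra.
From mathcomp Require Import all_classical all_reals all_analysis.

Set Implicit Arguments.
Unset Strict Implicit.
Unset Printing Implicit Defensive.

Import Order.TTheory GRing.Theory Num.Theory.
Import numFieldNormedType.Exports.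

Local Open Scope classical_set_scope.
Local Open Scope ring_scope.

(* The library's measurable types are pointed, so nonempty metric spaces are
   taken with a (never used) distinguished point. *)
#[short(type="pmetricType")]
HB.structure Definition PointedMetric (R : numDomainType) :=
  {T of Pointed T & Metric R T}.

(* A nonempty compact metrizable space with a compatible metric d is a
   pmetricType X (d is mdist) such that [set: X] is compact; C(X, R) is the set
   of functions f : X -> R such that continuous f. *)

Notation borel X := (g_sigma_algebraType (@open X)).

Section metric_mean_dimension.
Context {R : realType} {X : pmetricType R}.
Implicit Types (T : X -> X) (f : X -> R) (n : nat) (e : R) (U : set X).

Definition birkhoff_sum T f n (x : X) : R := \sum_(j < n) f (iter j T x).

(* Distances are nonnegative, so the default value 0 of the iterated maximum is
   harmless when n >= 1. *)
Definition bowen_dist T n (x y : X) : R :=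
  \big[Num.max/0]_(j < n) mdist (iter j T x) (iter j T y).

(* When X is compact and T, f are continuous, the real-valued sup and inf below
   are taken over nonempty bounded (resp. bounded below) sets. *)
Definition bowen_diam T n U : R :=
  sup [set r | exists x y, [/\ U x, U y & r = bowen_dist T n x y]].

Definition fine_cover T n e k (U : 'I_k -> set X) : Prop :=
  [/\ \bigcup_i U i = [set: X],
      forall i, U i !=set0 &
      forall i, bowen_diam T n (U i) < e].

Definition cover_sum T f n e : R :=
  inf [set s | exists k (U : 'I_k -> set X), fine_cover T n e U /\
    s = \sum_(i < k) e^-1 `^ sup (birkhoff_sum T f n @` U i)].

(* The limit exists for continuous T, f on a compact X and 0 < e < 1, since
   n |-> ln (cover_sum T f n e) is then subadditive and bounded below by a
   linear function of n. *)
Definition cover_growth T f e : R :=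
  limn (fun n => n%:R^-1 * ln (cover_sum T f n e) : R).

Definition upper_mdim T f : \bar R :=
  limf_esup (fun e => (cover_growth T f e / ln e^-1)%:E) 0^'+.

Definition zero_mdim_potentials T : set (X -> R) :=
  [set g : X -> R | continuous g /\ upper_mdim T (\- g) = 0%E].

Definition measure_upper_mdim T (mu : probability (borel X) R) : \bar R :=
  ereal_inf [set (\int[mu]_x (g x)%:E)%E | g in zero_mdim_potentials T].

Definition invariant_probabilities T : set (probability (borel X) R) :=
  [set mu : probability (borel X) R | forall A : set (borel X), measurable A ->
    pushforward mu (T : borel X -> borel X) A = mu A].

End metric_mean_dimension.

Definition is_maximum {R : realType} (S : set (\bar R)) (m : \bar R) : Prop :=
  S m /\ ubound S m.

(* Main.v *)
Require Import Defs.
From HB Require Import structures.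
From mathcomp Require Import all_boot all_order all_algebra.
From mathcomp Require Import all_classical all_reals all_analysis measurable_realfun.
From mathcomp Require Import ring lra.

Set Implicit Arguments.
Unset Strict Implicit.
Unset Printing Implicit Defensive.

Import Order.TTheory GRing.Theory Num.Theory.
Import numFieldNormedType.Exports.

Local Open Scope classical_set_scope.
Local Open Scope ring_scope.

(** Write P(f) for the upper metric mean dimension with potential f. The theorem
    is the Fenchel-Moreau duality for the function P on C(X, R), together with
    the remark that the slopes of P are invariant probability measures.

    The function P is finite, monotone, satisfies P(f + c) = P(f) + c for a
    constant c, does not see coboundaries h o T - h, and is convex. By
    translation, the potentials g with P(-g) = 0 are exactly the functions
    P(f) - f, so that F(mu) is the infimum over all continuous h of
    P(h) - int h dmu. Taking h = f gives F(mu) + int f dmu <= P(f), for every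
    probability mu. Equality at mu says that h |-> int h dmu is a subgradient of
    P at f: P(f + h) - P(f) >= int h dmu for all h. A linear subgradient L exists
    by the Hahn-Banach theorem ([hahn_banach_convex], [subgradient_exists]).
    Monotonicity of P makes L positive, translation gives L(1) = 1, and
    insensitivity to coboundaries gives L(h o T) = L(h). So L is the integral
    against a probability measure by the Riesz representation theorem
    ([daniell_measure], [integral_functional]), and this measure is invariant
    ([functional_invariant_measure]).

    Two points need work. First, cover sums need not be log-convex in the potential:
    two potentials may have different optimal covers, and Hoelder's inequality
    does not apply to the common refinement. Sums over a maximal separated set,
    which is the same for all potentials, do not have this defect. They are at
    most the cover sum at the same scale e and control the cover sum at scale
    3 e ([separated_sum_le_cover_sum], [cover_sum_le_spanning]). The change of
    scale and the oscillation of f at scale e cost only o(ln (1/e)), which is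
    invisible after division by ln (1/e) ([cover_growth_convex],
    [upper_mdim_convex]). Here the growth rates have to be limits, which
    follows from Fekete's lemma ([subadditive_cvg_div], [growth_is_cvg]).

    Second, the representing measure is built by Daniell's method: the outer
    measure of A is the infimum of the sums of the L(F n), over the sequences of
    nonnegative continuous functions F n whose sum is at least 1 on A. Countable
    subadditivity is then a matter of rearranging double series, and open sets
    are Caratheodory measurable because the indicator of an open set is an
    increasing limit of continuous functions. *)

(** * Convex functions and the Hahn-Banach theorem *)

(** By Zorn's lemma there is a maximal linear relation G between V and R that lies
    below p. Its domain is all of D: to extend G to a vector v, a value at v has
    to lie above the numbers (r - p (u - t v)) / t and below the numbers
    (p (u + s v) - r) / s, with (u, r) in G and s, t > 0. Convexity of p at the
    barycenter with weights s and t says that each of the former is at most each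
    of the latter. Relations are used in place of partial functions because
    a linear relation below p is automatically single-valued. *)
Lemma hahn_banach_convex (R : realType) (V : lmodType R) (D : set V)
    (p : V -> R) :
  D 0 ->
  (forall (a : R) u v, D u -> D v -> D (a *: u + v)) ->
  p 0 = 0 ->
  (forall (t : R) u v, 0 <= t <= 1 -> D u -> D v ->
    p (t *: u + (1 - t) *: v) <= t * p u + (1 - t) * p v) ->
  exists L : V -> R,
    (forall (a : R) u v, D u -> D v -> L (a *: u + v) = a * L u + L v) /\
    (forall u, D u -> L u <= p u).
Proof.
move=> D0 Dlin p0 pconv.
pose P (G : set (V * R)) :=
  (forall a x y, G x -> G y -> G (a *: x.1 + y.1, a * x.2 + y.2)) /\
  (forall x, G x -> D x.1 /\ x.2 <= p x.1).
have [|G [[Glin Gp] Gmax]] := @Zorn_bigcup _ P.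
  move=> F FP Ftot; split.
    move=> a x y [A FA Ax] [B FB By].
    have [AB|BA] := Ftot _ _ FA FB.
      by exists B => //; apply: (FP _ FB).1 => //; exact: AB.
    by exists A => //; apply: (FP _ FA).1 => //; exact: BA.
  by move=> x [A FA Ax]; exact: (FP _ FA).2.
have maxG (G' : set (V * R)) : G `<=` G' -> P G' -> G' `<=` G.
  by move=> GG' PG'; apply: contrapT => nG'; apply: (Gmax G') => //; split.
have G0 : G (0, 0).
  have [[z Gz]|nG] := pselect (exists z, G z).
    have := Glin (-1) _ _ Gz Gz.
    by rewrite scaleN1r addNr mulN1r addNr.
  apply: (maxG [set (0, 0)]) => //.
    by move=> z Gz; case: nG; exists z.
  split=> [a x y -> ->|x ->] /=.
    by rewrite scaler0 mulr0 !addr0.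
  by rewrite p0.
have D1 u v : D u -> D v -> D (u + v).
  by move=> Du Dv; rewrite -[u]scale1r; exact: Dlin.
have DZ a u : D u -> D (a *: u).
  by move=> Du; rewrite -[_ *: _]addr0; exact: Dlin.
have Gdom v : D v -> exists r, G (v, r).
  move=> Dv.
  pose S := [set q | exists x (t : R), [/\ G x, 0 < t &
    q = (x.2 - p (x.1 - t *: v)) / t]].
  have S0 : S !=set0 by exists ((0 - p (0 - 1 *: v)) / 1); exists (0, 0), 1.
  have Sub y (s : R) : G y -> 0 < s -> ubound S ((p (y.1 + s *: v) - y.2) / s).
    move=> Gy s0 _ [x [t [Gx t0 ->]]].
    rewrite ler_pdivrMr// mulrAC ler_pdivlMr//.
    have st0 : 0 < s + t by rewrite addr_gt0.
    (* the weight for which the multiples of v cancel in the barycenter *)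
  pose c := s / (s + t).
    have c01 : 0 <= c <= 1.
      by rewrite /c ler_pdivrMr// mul1r lerDl (ltW t0) andbT divr_ge0// ltW.
    have c1 : 1 - c = t / (s + t) by rewrite /c; field; rewrite gt_eqF.
    have := pconv c (x.1 - t *: v) (y.1 + s *: v) c01.
    have Dx := (Gp _ Gx).1; have Dy := (Gp _ Gy).1.
    rewrite -scaleNr => /(_ (D1 _ _ Dx (DZ _ _ Dv)) (D1 _ _ Dy (DZ _ _ Dv))).
    have -> : c *: (x.1 + (- t) *: v) + (1 - c) *: (y.1 + s *: v) =
              c *: x.1 + (1 - c) *: y.1.
      rewrite !scalerDr !scalerA addrACA -scalerDl.
      rewrite [X in X *: v](_ : _ = 0) ?scale0r ?addr0//.
      by rewrite c1 /c; field; rewrite gt_eqF.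
    have Gxy : G (c *: x.1 + (1 - c) *: y.1, c * x.2 + (1 - c) * y.2).
      have Gy' : G ((1 - c) *: y.1, (1 - c) * y.2).
        by have := Glin (1 - c) _ _ Gy G0; rewrite /= !addr0.
      exact: (Glin c _ _ Gx Gy').
    move=> /(le_trans (Gp _ Gxy).2) /=.
    rewrite c1 /c -(ler_pM2r st0).
    have -> : (s / (s + t) * x.2 + t / (s + t) * y.2) * (s + t) =
      s * x.2 + t * y.2 by field; rewrite gt_eqF.
    set A := p _; set B := p _.
    have -> : (s / (s + t) * A + t / (s + t) * B) * (s + t) =
      s * A + t * B by field; rewrite gt_eqF.
    nra.
  pose a := sup S; exists a.
  have hubS : has_ubound S by eexists; exact: (Sub _ _ G0 ltr01).
  apply: (maxG [set z | exists x (s : R), G x /\ z = (x.1 + s *: v, x.2 + s * a)]).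
  - move=> x Gx; exists x, 0; split => //.
    by rewrite scale0r mul0r !addr0; case: x {Gx}.
  - split.
      move=> b _ _ [x [s [Gx ->]]] [y [t [Gy ->]]] /=.
      exists (b *: x.1 + y.1, b * x.2 + y.2), (b * s + t); split.
        exact: Glin.
      congr pair => /=; last by ring.
      by rewrite scalerDr scalerA scalerDl addrACA.
    move=> _ [x [s [Gx ->]]] /=; have [Dx xp] := Gp _ Gx.
    split; first by apply: D1 => //; exact: DZ.
    have [s0|s0|->] := ltgtP s 0; last by rewrite scale0r mul0r !addr0.
      have t0 : 0 < - s by rewrite oppr_gt0.
      have : (x.2 - p (x.1 - (- s) *: v)) / - s <= a.
        by apply: ub_le_sup => //; exists x, (- s).
      rewrite ler_pdivrMr// scaleNr opprK; nra.
    have : a <= (p (x.1 + s *: v) - x.2) / s by apply: ge_sup => //; exact: Sub.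
    rewrite ler_pdivlMr//; nra.
  - by exists (0, 0), 1; split => //=; rewrite scale1r mul1r !add0r.
have Guniq v r r' : G (v, r) -> G (v, r') -> r = r'.
  move=> Gr Gr'.
  have G1 : G (0, r' - r).
    by have := Glin (-1) _ _ Gr Gr'; rewrite /= scaleN1r mulN1r addNr addrC.
  have G2 t : t * (r' - r) <= 0.
    have := Glin t _ _ G1 G0; rewrite /= scaler0 !addr0.
    by move=> /Gp[_]/=; rewrite p0.
  by have := G2 (r' - r); nra.
pose L v := xget 0 [set r | G (v, r)].
have GL v : D v -> G (v, L v).
  by move=> /Gdom[r Gr]; have /= := @xgetI _ 0 [set r | G (v, r)] _ Gr.
exists L; split=> [a u v Du Dv|u Du]; last exact: (Gp _ (GL _ Du)).2.
apply: (@Guniq (a *: u + v)); first by apply: GL; exact: Dlin.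
exact: (Glin a _ _ (GL _ Du) (GL _ Dv)).
Qed.

(** The tangent line of exp at the barycenter lies below the graph. *)
Lemma expR_convex (R : realType) (t a b : R) : 0 <= t <= 1 ->
  expR (t * a + (1 - t) * b) <= t * expR a + (1 - t) * expR b.
Proof.
move=> /andP[t0 t1]; set c := t * a + _.
have ha : expR c * (1 + (a - c)) <= expR a.
  have -> : expR a = expR c * expR (a - c) by rewrite -expRD subrKC.
  by rewrite ler_pM2l ?expR_gt0// expR_ge1Dx.
have hb : expR c * (1 + (b - c)) <= expR b.
  have -> : expR b = expR c * expR (b - c) by rewrite -expRD subrKC.
  by rewrite ler_pM2l ?expR_gt0// expR_ge1Dx.
have -> : expR c = t * (expR c * (1 + (a - c))) +
                   (1 - t) * (expR c * (1 + (b - c))) by rewrite /c; ring.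
by rewrite lerD// ler_wpM2l// subr_ge0.
Qed.

(** Hoelder's inequality for the exponents 1/t and 1/(1-t), in logarithmic form.
    After normalization by A and B it is the convexity of exp, term by term. *)
Lemma hoelder_sum_expR (R : realType) (I : finType) (t : R) (a b : I -> R)
    (A B : R) : 0 <= t <= 1 -> 0 < A -> 0 < B ->
  \sum_i expR (a i) <= A -> \sum_i expR (b i) <= B ->
  \sum_i expR (t * a i + (1 - t) * b i) <= expR (t * ln A + (1 - t) * ln B).
Proof.
move=> t01 A0 B0 aA bB; have /andP[t0 t1] := t01.
rewrite -[leRHS]mul1r -ler_pdivrMr ?expR_gt0// mulr_suml.
apply: (@le_trans _ _
    (t * ((\sum_i expR (a i)) / A) + (1 - t) * ((\sum_i expR (b i)) / B))).
  rewrite !mulr_suml !mulr_sumr -big_split/=; apply: ler_sum => i _.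
  rewrite -expRB (_ : _ - _ = t * (a i - ln A) + (1 - t) * (b i - ln B)).
    by rewrite (le_trans (expR_convex _ _ t01))// !expRB !lnK ?posrE.
  by ring.
have hA : (\sum_i expR (a i)) / A <= 1 by rewrite ler_pdivrMr// mul1r.
have hB : (\sum_i expR (b i)) / B <= 1 by rewrite ler_pdivrMr// mul1r.
have t1' : 0 <= 1 - t by rewrite subr_ge0.
by have := ler_wpM2l t0 hA; have := ler_wpM2l t1' hB; lra.
Qed.

(** * Limits of subadditive sequences *)

(** Fekete's lemma. The limit is the infimum l of a n / n. If a m / m < l + e/2,
    then b n = a n - n (l + e/2) is subadditive with b m <= 0, hence bounded above
    by its values at the residues modulo m. *)
Lemma subadditive_cvg_div (R : realType) (a : nat -> R) (K : R) :
  (forall m n, a (m + n)%N <= a m + a n) ->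
  (forall n, - (n%:R * K) <= a n) ->
  cvgn (fun n => n%:R^-1 * a n : R).
Proof.
move=> asub alb.
pose S := [set q | exists n, (0 < n)%N /\ q = n%:R^-1 * a n].
have Slb : has_lbound S.
  exists (- K) => _ [n [n0 ->]].
  by rewrite ler_pdivlMl ?ltr0n// mulrN.
have S0 : S !=set0 by exists (1%:R^-1 * a 1%N), 1%N.
pose l := inf S.
apply: (@cvgP _ _ l); apply/cvgrPdist_le => /= e e0.
have e20 : 0 < e / 2 by rewrite divr_gt0.
have [_ [m [m0 ->]] lm] := inf_adherent e20 (conj S0 Slb).
pose b n := a n - n%:R * (l + e / 2).
have bm : b m <= 0.
  by rewrite /b subr_le0 -ler_pdivrMl ?ltr0n// ltW.
have bD n k : b (n + k)%N <= b n + b k.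
  by rewrite /b natrD; have := asub n k; lra.
have bq q r : b (q * m + r)%N <= b r.
  elim: q => [|q IH]; first by rewrite mul0n add0n.
  by rewrite mulSn -addnA (le_trans (bD _ _))//; lra.
pose B := \sum_(r < m) `|b r|.
have bB n : b n <= B.
  rewrite [n in b n](divn_eq n m) (le_trans (bq _ _))//.
  rewrite (le_trans (ler_norm _))// /B.
  rewrite (bigD1 (Ordinal (ltn_pmod n m0)))//= lerDl.
  exact: sumr_ge0.
near=> n.
have n0 : (0 < n)%N by near: n; exact: nbhs_infty_gt.
have nR0 : (0 : R) < n%:R by rewrite ltr0n.
have ln : l <= n%:R^-1 * a n by apply: ge_inf => //; exists n.
rewrite distrC ger0_norm ?subr_ge0// lerBlDl ler_pdivrMl//.
have nB : B / (e / 2) <= n%:R by near: n; exact: nbhs_infty_ger.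
rewrite ler_pdivrMr// in nB.
have := bB n; rewrite /b; lra.
Unshelve. all: by end_near. Qed.

(** The error term K / n absorbs the bounded discrepancies that coboundaries
    create. *)
Lemma limn_le_affine (R : realType) (u v w : nat -> R) (s t C K : R) :
  cvgn u -> cvgn v -> cvgn w ->
  (forall n, (0 < n)%N -> u n <= s * v n + t * w n + C + K * n%:R^-1) ->
  limn u <= s * limn v + t * limn w + C.
Proof.
move=> cu cv cw h.
have K0 : K * n%:R^-1 @[n --> \oo] --> (0 : R).
  rewrite -(mulr0 K); apply: cvgMr.
  apply/gtr0_cvgV0; last exact: cvgr_idn.
  by near=> n; rewrite ltr0n; near: n; exact: nbhs_infty_gt.
have cR : s * v n + t * w n + C + K * n%:R^-1 @[n --> \oo] -->
    s * limn v + t * limn w + C.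
  rewrite -[X in _ --> X]addr0; apply: cvgD K0.
  apply: cvgD; last exact: cvg_cst.
  by apply: cvgD; apply: cvgMr.
rewrite -(cvg_lim _ cR)//; apply: ler_lim => //.
  by apply/cvg_ex; eexists; exact: cR.
by near=> n; apply: h; near: n; exact: nbhs_infty_gt.
Unshelve. all: by end_near. Qed.

(** * Compact metric spaces and Bowen distances *)

Section metric_facts.
Context {R : realType} {X : pmetricType R}.
Implicit Types (f g : X -> R).

Lemma lipschitz_continuous_mdist (K : R) f :
  (forall x y, f y <= f x + K * mdist x y) -> continuous f.
Proof.
move=> fK x; apply/cvgrPdist_lt => /= e e0.
pose K' := `|K| + 1; have K'0 : 0 < K' by rewrite ltr_pwDr.
have : \forall y \near x, ball x (e / K') y.
  by apply: nbhsx_ballx; rewrite divr_gt0.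
apply: filterS => y; rewrite ballEmdist/= ltr_pdivlMr// => xy.
have Kxy : K * mdist x y < e.
  rewrite mulrC (le_lt_trans _ xy)// ler_wpM2l ?mdist_ge0//.
  by rewrite (le_trans (ler_norm K))// lerDl.
have := fK x y; have := fK y x; rewrite (metric_sym y x) => h1 h2.
by rewrite ltr_norml; lra.
Qed.

Lemma mdist_continuous (x : X) : continuous (mdist x).
Proof.
by apply: (@lipschitz_continuous_mdist 1) => y z; rewrite mul1r metric_triangle.
Qed.

Context (Xc : compact [set: X]).

Lemma continuous_bounded f : continuous f ->
  exists2 M, 0 <= M & forall x, `|f x| <= M.
Proof.
move=> fc.
have nfc : {within [set: X], continuous (fun x => `|f x|)}.
  apply: continuous_subspaceT => x.
  by apply: continuous_comp; [exact: fc|exact: norm_continuous].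
have [c _ cM] := compact_EVT_max (ex_intro _ point I) Xc nfc.
by exists `|f c| => // x; apply: cM; rewrite inE.
Qed.

Lemma mdist_bounded : exists D : R, forall x y : X, mdist x y <= D.
Proof.
have [M M0 hM] := continuous_bounded (@mdist_continuous point).
exists (M + M) => x y; rewrite (le_trans (metric_triangle x point y))// lerD//.
  by rewrite metric_sym (le_trans (ler_norm _)).
by rewrite (le_trans (ler_norm _)).
Qed.

(** Uniform continuity, in the one-sided form that the comparison of suprema
    uses. *)
Lemma compact_uniform_modulus f : continuous f ->
  forall eta, 0 < eta -> \forall e \near 0^'+,
    forall x y, mdist x y < e -> f y <= f x + eta.
Proof.
move=> fc eta eta0.
have /compact_near_coveringP/(_ R 0^'+
    (fun e x => forall y, mdist x y < e -> f y <= f x + eta) _) := Xc.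
move=> H; suff : \forall e \near 0^'+, [set: X] `<=`
    (fun x => forall y, mdist x y < e -> f y <= f x + eta).
  by apply: filterS => e He x y; exact: He.
apply: H => x _.
have eta20 : 0 < eta / 2 by rewrite divr_gt0.
have /cvgrPdist_lt/(_ _ eta20) := fc x.
rewrite -(@nbhs_ballE _ X) => -[d /= d0 hd].
exists (ball x (d / 2), [set e | e < d / 2]) => /=.
  split; first by apply: nbhsx_ballx; rewrite divr_gt0.
  by apply: nbhs_right_lt; rewrite divr_gt0.
move=> [z e] /= [xz ed] y zy.
rewrite ballEmdist/= in xz.
have := hd z; have := hd y; rewrite !ballEmdist/=.
have xy := metric_triangle x z y.
move=> /(_ _)/wrap[]; first by lra.
move=> h1 /(_ _)/wrap[]; first by have := mdist_ge0 z y; lra.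
by move: h1; rewrite !ltr_norml => /andP[h1 h2] /andP[h3 h4]; lra.
Qed.

End metric_facts.

Section bowen_metric.
Context {R : realType} {X : pmetricType R} (T : X -> X).
Implicit Types (n : nat) (c e : R) (x y z : X) (U : set X).

Lemma bowen_distP n c x y : 0 <= c ->
  reflect (forall j, (j < n)%N -> mdist (iter j T x) (iter j T y) <= c)
          (bowen_dist T n x y <= c).
Proof.
move=> c0; apply: (iffP idP) => [/bigmax_leP[_ h] j jn|h].
  exact: (h (Ordinal jn)).
by apply/bigmax_leP; split => // j _; exact: h.
Qed.

Lemma bowen_dist_ltP n c x y : 0 < c ->
  reflect (forall j, (j < n)%N -> mdist (iter j T x) (iter j T y) < c)
          (bowen_dist T n x y < c).
Proof.
move=> c0; apply: (iffP idP) => [/bigmax_ltP[_ h] j jn|h].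
  exact: (h (Ordinal jn)).
by apply/bigmax_ltP; split => // j _; exact: h.
Qed.

Lemma bowen_dist_ge0 n x y : 0 <= bowen_dist T n x y.
Proof. exact: bigmax_ge_id. Qed.

Lemma bowen_dist_ge n x y j : (j < n)%N ->
  mdist (iter j T x) (iter j T y) <= bowen_dist T n x y.
Proof.
move=> jn; have /bowen_distP := lexx (bowen_dist T n x y).
by apply; rewrite ?bowen_dist_ge0.
Qed.

Lemma bowen_distxx n x : bowen_dist T n x x = 0.
Proof.
apply/eqP; rewrite eq_le bowen_dist_ge0 andbT.
by apply/bowen_distP => // j _; rewrite mdistxx.
Qed.

Lemma bowen_dist_sym n x y : bowen_dist T n x y = bowen_dist T n y x.
Proof. by apply: eq_bigr => j _; rewrite metric_sym. Qed.

Lemma bowen_dist_triangle n x y z :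
  bowen_dist T n x z <= bowen_dist T n x y + bowen_dist T n y z.
Proof.
apply/bowen_distP => [|j jn]; first by rewrite addr_ge0 ?bowen_dist_ge0.
rewrite (le_trans (metric_triangle _ (iter j T y) _))//.
by rewrite lerD// bowen_dist_ge.
Qed.

(** The Bowen distance of order m + n is the maximum of the one of order m at the
    starting points and of the one of order n at the m-th iterates. *)
Lemma bowen_distD m n x y c : 0 <= c ->
  bowen_dist T m x y <= c -> bowen_dist T n (iter m T x) (iter m T y) <= c ->
  bowen_dist T (m + n) x y <= c.
Proof.
move=> c0 /bowen_distP h1 /bowen_distP h2; apply/bowen_distP => // j jmn.
have [jm|mj] := ltnP j m; first exact: h1.
have := h2 c0 (j - m)%N; rewrite -!iterD subnK//; apply.
by rewrite ltn_subLR.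
Qed.

Lemma birkhoff_sumD f m n x :
  birkhoff_sum T f (m + n) x =
  birkhoff_sum T f m x + birkhoff_sum T f n (iter m T x) :> R.
Proof.
rewrite /birkhoff_sum big_split_ord/=; congr (_ + _).
by apply: eq_bigr => j _; rewrite -iterD addnC.
Qed.

Lemma birkhoff_sum_bound f M n x : (forall x, `|f x| <= M) ->
  `|birkhoff_sum T f n x| <= n%:R * M.
Proof.
move=> fM; rewrite (le_trans (ler_norm_sum _ _ _))//.
have -> : n%:R * M = \sum_(j < n) M by rewrite sumr_const card_ord mulr_natl.
by apply: ler_sum => j _; exact: fM.
Qed.

Lemma birkhoff_sum_modulus f n e eta x y : 0 < e ->
  (forall x y, mdist x y < e -> f y <= f x + eta) ->
  bowen_dist T n x y < e ->
  birkhoff_sum T f n y <= birkhoff_sum T f n x + n%:R * eta.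
Proof.
move=> e0 fe /bowen_dist_ltP h; rewrite /birkhoff_sum.
have -> : n%:R * eta = \sum_(j < n) eta.
  by rewrite sumr_const card_ord mulr_natl.
by rewrite -big_split/=; apply: ler_sum => j _; apply: fe; apply: h.
Qed.

Context (Xc : compact [set: X]).

Lemma bowen_diam_has_ubound n U :
  has_ubound [set r | exists x y, [/\ U x, U y & r = bowen_dist T n x y]].
Proof.
have [D hD] := mdist_bounded Xc; exists D => _ [x [y [_ _ ->]]].
by apply/bowen_distP => [|j _ //]; rewrite (le_trans _ (hD x x))// mdist_ge0.
Qed.

Lemma bowen_dist_le_diam n U x y :
  U x -> U y -> bowen_dist T n x y <= bowen_diam T n U.
Proof.
move=> Ux Uy; apply: ub_le_sup; first exact: bowen_diam_has_ubound.
by exists x, y.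
Qed.

Lemma bowen_diam_le n U c : U !=set0 ->
  (forall x y, U x -> U y -> bowen_dist T n x y <= c) -> bowen_diam T n U <= c.
Proof.
move=> [x Ux] h; apply: ge_sup; first by exists (bowen_dist T n x x), x, x.
by move=> _ [y [z [Uy Uz ->]]]; exact: h.
Qed.

Lemma sup_birkhoff_ge f n U x : continuous f -> U x ->
  birkhoff_sum T f n x <= sup (birkhoff_sum T f n @` U) :> R.
Proof.
move=> fc Ux; have [M _ fM] := continuous_bounded Xc fc.
apply: ub_le_sup; last by exists x.
exists (n%:R * M) => _ [y _ <-].
by rewrite (le_trans (ler_norm _))// birkhoff_sum_bound.
Qed.

Lemma sup_birkhoff_le (f : X -> R) n U c : U !=set0 ->
  (forall x, U x -> birkhoff_sum T f n x <= c) ->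
  sup (birkhoff_sum T f n @` U) <= c.
Proof.
move=> U0 h; apply: ge_sup; first exact: image_nonempty.
by move=> _ [x Ux <-]; exact: h.
Qed.

Context (Tc : continuous T).

Lemma iter_continuous j : continuous (iter j T).
Proof.
elim: j => [|j IH] x; first exact: cvg_id.
by apply: (@continuous_comp _ _ _ (iter j T) T); [exact: IH|exact: Tc].
Qed.

Lemma bowen_ball_nbhs n x e : 0 < e -> \forall y \near x, bowen_dist T n x y < e.
Proof.
move=> e0.
have H (j : 'I_n) : \forall y \near x, mdist (iter j T x) (iter j T y) < e.
  have Hj : nbhs x (iter j T @^-1` ball (iter j T x) e).
    exact: (@iter_continuous j x _ (nbhsx_ballx (iter j T x) e e0)).
  by apply: filterS Hj => y /=; rewrite ballEmdist.
apply: filterS (@filter_forall _ _ _ _ _ H) => y hy.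
by apply/bowen_dist_ltP => // j jn; exact: (hy (Ordinal jn)).
Qed.

(** The balls of the Bowen distance are neighborhoods because T is continuous, so
    finitely many of them cover the compact space X. *)
Lemma finite_bowen_spanning n e : 0 < e ->
  exists (I : finType) (s : I -> X), forall y, exists i, bowen_dist T n (s i) y < e.
Proof.
move=> e0; have := Xc; rewrite compact_cover => /(_ X setT
  (fun x => interior [set y | bowen_dist T n x y < e]))[].
- by move=> x _; exact: open_interior.
- by move=> x _; exists x => //; exact: bowen_ball_nbhs.
move=> D' _ cov; exists (seq_sub (finmap.enum_fset D')), val => y.
have [x xD' xy] := cov y I.
by exists (SeqSub xD'); exact: interior_subset xy.
Qed.

End bowen_metric.

(** * Cover sums and their growth rates *)

Section cover_sums.
Context {R : realType} {X : pmetricType R} (T : X -> X).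
Context (Xc : compact [set: X]) (Tc : continuous T).
Implicit Types (f g : X -> R) (n : nat) (e : R) (U : set X).

(** Covers produced by refinement or by separated sets come with an index type
    other than an ordinal, and some of their members have to be discarded. *)
Lemma cover_sum_le_fin f n e (I : finType) (P : pred I) (U : I -> set X) :
  (forall x, exists2 i, P i & U i x) ->
  (forall i, P i -> U i !=set0) ->
  (forall i, P i -> bowen_diam T n (U i) < e) ->
  cover_sum T f n e <=
    \sum_(i | P i) e^-1 `^ sup (birkhoff_sum T f n @` U i).
Proof.
move=> Ucov U0 Ue; apply: ge_inf.
  by exists 0 => _ [k [V [_ ->]]]; apply: sumr_ge0 => i _; exact: powR_ge0.
exists #|P|, (fun i => U (enum_val i)); split; last first.
  exact: (@big_enum_val _ _ _ _ P (fun i => e^-1 `^ sup (birkhoff_sum T f n @` U i))).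
split=> [|i|i]; last 2 first.
- exact: U0 (enum_valP i).
- exact: Ue (enum_valP i).
rewrite -subTset => x _; have [i Pi Uix] := Ucov x.
by exists (enum_rank_in Pi i) => //; rewrite enum_rankK_in.
Qed.

Lemma fine_cover_exists n e : 0 < e ->
  exists k (U : 'I_k -> set X), fine_cover T n e U.
Proof.
move=> e0; have e30 : 0 < e / 3 by rewrite divr_gt0.
have [I [s hs]] := finite_bowen_spanning Xc Tc n e30.
exists #|I|, (fun i : 'I_#|I| => [set y | bowen_dist T n (s (enum_val i)) y < e / 3]).
have U0 (i : 'I_#|I|) : [set y | bowen_dist T n (s (enum_val i)) y < e / 3] !=set0.
  by exists (s (enum_val i)); rewrite /= bowen_distxx.
split => //.
- rewrite -subTset => y _; have [i iy] := hs y.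
  by exists (enum_rank i) => //=; rewrite enum_rankK.
- move=> i; apply: (@le_lt_trans _ _ (e / 3 + e / 3)); last by lra.
  apply: bowen_diam_le => // y z /= yi zi.
  rewrite (le_trans (bowen_dist_triangle T n y (s (enum_val i)) z))//.
  by rewrite lerD ?ltW// bowen_dist_sym.
Qed.

Lemma cover_sum_ge f n e (c : R) : 0 < e ->
  (forall k (U : 'I_k -> set X), fine_cover T n e U ->
    c <= \sum_(i < k) e^-1 `^ sup (birkhoff_sum T f n @` U i)) ->
  c <= cover_sum T f n e.
Proof.
move=> e0 h; apply: lb_le_inf.
  have [k [U Uf]] := fine_cover_exists n e0.
  by eexists; exists k, U; split; [exact: Uf|reflexivity].
by move=> _ [k [U [Uf ->]]]; exact: h.
Qed.

Lemma inv_gt1 e : 0 < e < 1 -> 1 < e^-1.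
Proof. by move=> /andP[e0 e1]; rewrite invf_gt1. Qed.

Lemma powR_inv_expR e (s : R) : 0 < e -> e^-1 `^ s = expR (s * ln e^-1).
Proof. by move=> e0; rewrite /powR gt_eqF// invr_gt0. Qed.

Lemma cover_sum_lower_bound f n e (M : R) : 0 < e < 1 ->
  continuous f -> (forall x, `|f x| <= M) ->
  expR (- (n%:R * M) * ln e^-1) <= cover_sum T f n e.
Proof.
move=> e01 fc fM; have /andP[e0 e1] := e01.
apply: cover_sum_ge => // k U [Ucov U0 _].
have : [set: X] point by [].
rewrite -Ucov => -[i _ Ui]; rewrite (bigD1 i)//=.
apply: (@le_trans _ _ (e^-1 `^ sup (birkhoff_sum T f n @` U i))); last first.
  by rewrite lerDl sumr_ge0// => j _; exact: powR_ge0.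
rewrite -powR_inv_expR//; apply: ler_powR; first by rewrite ltW// inv_gt1.
rewrite (le_trans _ (sup_birkhoff_ge T Xc n fc Ui))//.
by have := birkhoff_sum_bound T n point fM; rewrite ler_norml => /andP[].
Qed.

Lemma cover_sum_gt0 f n e : 0 < e < 1 -> continuous f -> 0 < cover_sum T f n e.
Proof.
move=> e01 fc; have [M _ fM] := continuous_bounded Xc fc.
by apply: lt_le_trans (cover_sum_lower_bound n e01 fc fM); exact: expR_gt0.
Qed.

Lemma ln_cover_sum_lower_bound f n e (M : R) : 0 < e < 1 ->
  continuous f -> (forall x, `|f x| <= M) ->
  - (n%:R * (M * ln e^-1)) <= ln (cover_sum T f n e).
Proof.
move=> e01 fc fM; rewrite mulrA -mulNr -[leLHS]expRK ler_ln ?posrE ?expR_gt0//.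
  exact: cover_sum_lower_bound.
exact: cover_sum_gt0.
Qed.

(** A bound S_n f <= S_n g + C multiplies each weight by at most (1/e)^C. All the
    comparisons of potentials (monotonicity, translation by constants and
    coboundaries) are instances of it. *)
Lemma ln_cover_sum_le f g n e (C : R) : 0 < e < 1 -> continuous f -> continuous g ->
  (forall x, birkhoff_sum T f n x <= birkhoff_sum T g n x + C) ->
  ln (cover_sum T f n e) <= ln (cover_sum T g n e) + C * ln e^-1.
Proof.
move=> e01 fc gc fg; have /andP[e0 e1] := e01.
rewrite -[X in _ + X]expRK -lnM ?posrE ?expR_gt0 ?cover_sum_gt0//.
rewrite ler_ln ?posrE ?mulr_gt0 ?expR_gt0 ?cover_sum_gt0//.
rewrite -ler_pdivrMr ?expR_gt0//; apply: cover_sum_ge => // k U [Ucov U0 Ue].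
rewrite ler_pdivrMr ?expR_gt0// mulr_suml.
apply: (le_trans (@cover_sum_le_fin f n e _ xpredT U _ _ _)) => //.
  by move=> x; have : [set: X] x by []; rewrite -Ucov => -[i _ Ui]; exists i.
apply: ler_sum => i _; rewrite -powR_inv_expR// -powRD; last first.
  by apply/implyP => _; rewrite gt_eqF// invr_gt0.
apply: ler_powR; first by rewrite ltW// inv_gt1.
apply: sup_birkhoff_le => // x Ux.
by rewrite (le_trans (fg x))// lerD2r sup_birkhoff_ge.
Qed.

(** If the U i are fine for m steps and the V j for n steps, then the nonempty sets
    among the U i `&` T^-m (V j) are fine for m + n steps, and the weights multiply
    by the cocycle identity for Birkhoff sums. *)
Lemma cover_sum_submultiplicative f m n e : 0 < e < 1 -> continuous f ->
  cover_sum T f (m + n) e <= cover_sum T f m e * cover_sum T f n e.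
Proof.
move=> e01 fc; have /andP[e0 e1] := e01.
rewrite -ler_pdivrMr ?cover_sum_gt0//; apply: cover_sum_ge => // k U Uf.
rewrite ler_pdivrMr ?cover_sum_gt0//.
set A := \sum_(i < k) _.
have A0 : 0 < A.
  apply: (lt_le_trans (cover_sum_gt0 m e01 fc)); apply: ge_inf; last by exists k, U.
  by exists 0 => _ [l [V [_ ->]]]; apply: sumr_ge0 => i _; exact: powR_ge0.
rewrite mulrC -ler_pdivrMr//; apply: cover_sum_ge => // l V Vf.
rewrite ler_pdivrMr// mulrC mulr_suml.
case: Uf => Ucov U0 Ue; case: Vf => Vcov V0 Ve.
pose W (p : 'I_k * 'I_l) := U p.1 `&` iter m T @^-1` V p.2.
pose P p := `[< W p !=set0 >].
apply: (le_trans (@cover_sum_le_fin f (m + n) e _ P W _ _ _)).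
- move=> x; have : [set: X] x by []; rewrite -Ucov => -[i _ Ui].
  have : [set: X] (iter m T x) by []; rewrite -Vcov => -[j _ Vj].
  by exists (i, j) => //; apply/asboolP; exists x.
- by move=> p /asboolP.
- move=> [i j] /asboolP W0.
  apply: (@le_lt_trans _ _ (Num.max (bowen_diam T m (U i)) (bowen_diam T n (V j)))).
    apply: bowen_diam_le => // x y [Ux Vx] [Uy Vy].
    apply: bowen_distD.
    - rewrite le_max (le_trans (bowen_dist_ge0 T m x x))//.
      exact: bowen_dist_le_diam.
    - by rewrite le_max bowen_dist_le_diam.
    - by rewrite le_max (@bowen_dist_le_diam _ _ _ Xc n (V j)) ?orbT.
  by rewrite gt_max Ue Ve.
under [leRHS]eq_bigr do rewrite mulr_sumr.
rewrite pair_big/= [leRHS](bigID P)/= -[leLHS]addr0 lerD//; last first.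
  by apply: sumr_ge0 => p _; rewrite mulr_ge0// powR_ge0.
apply: ler_sum => -[i j] /asboolP W0 /=.
rewrite -powRD; last by apply/implyP => _; rewrite gt_eqF// invr_gt0.
apply: ler_powR; first by rewrite ltW// inv_gt1.
apply: sup_birkhoff_le => // x [Ux Vx].
by rewrite birkhoff_sumD lerD// sup_birkhoff_ge.
Qed.

Lemma growth_is_cvg f e : 0 < e < 1 -> continuous f ->
  cvgn (fun n => n%:R^-1 * ln (cover_sum T f n e) : R).
Proof.
move=> e01 fc; have [M _ fM] := continuous_bounded Xc fc.
apply: (@subadditive_cvg_div _ _ (M * ln e^-1)) => [m n|n].
  rewrite -lnM ?posrE ?cover_sum_gt0// ler_ln ?posrE ?mulr_gt0 ?cover_sum_gt0//.
  exact: cover_sum_submultiplicative.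
exact: ln_cover_sum_lower_bound.
Qed.

End cover_sums.

(** * Separated sets and convexity at a fixed scale *)

Section separated_sets.
Context {R : realType} {X : pmetricType R} (T : X -> X).
Context (Xc : compact [set: X]) (Tc : continuous T).
Implicit Types (f g : X -> R) (n : nat) (e t : R).

Definition bowen_separated n e m (s : 'I_m -> X) :=
  forall i j, i != j -> e <= bowen_dist T n (s i) (s j).

(** The size of an e-separated family is bounded by the number of balls of radius
    e/2 needed to cover X, so there is one of maximal size, and maximality says
    that it is e-spanning. *)
Lemma maximal_separated n e : 0 < e -> exists m (s : 'I_m -> X),
  bowen_separated n e s /\ forall y, exists i, bowen_dist T n (s i) y < e.
Proof.
move=> e0; have e20 : 0 < e / 2 by rewrite divr_gt0.
have [I [c hc]] := finite_bowen_spanning Xc Tc n e20.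
pose P m := `[< exists s : 'I_m -> X, bowen_separated n e s >].
have P0 : exists m, P m.
  by exists 0%N; apply/asboolP; exists (fun=> point); case.
have Pub m : P m -> (m <= #|I|)%N.
  move=> /asboolP[s sep].
  have [phi hphi] := choice (fun i => hc (s i)).
  rewrite -[m]card_ord; apply: (@leq_card _ _ phi) => i j ij.
  apply: contra_eq (ij) => /sep sij; apply/eqP => phiij.
  have := bowen_dist_triangle T n (s i) (c (phi i)) (s j).
  have := hphi i; have := hphi j; rewrite -phiij (bowen_dist_sym _ _ (s i) (c (phi i))).
  by lra.
case: (ex_maxnP P0 Pub) => m /asboolP[s sep] mmax.
exists m, s; split => // y; apply: contrapT => /forallNP hy.
have far i : e <= bowen_dist T n (s i) y by rewrite leNgt; exact/negP/hy.
have /mmax : P m.+1; last by rewrite ltnn.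
(* otherwise s could be enlarged by y *)
apply/asboolP; exists (fun i => oapp s y (unlift ord_max i)) => i j.
case: unliftP => [i'|] ->; case: unliftP => [j'|] -> //=.
- by move=> ij; apply: sep; apply: contraNneq ij => ->.
- by move=> _; rewrite bowen_dist_sym.
- by rewrite eqxx.
Qed.

(** A set of diameter less than e contains at most one point of an e-separated
    family. *)
Lemma separated_sum_le_cover_sum f n e m (s : 'I_m -> X) :
  0 < e < 1 -> continuous f -> bowen_separated n e s ->
  \sum_(i < m) e^-1 `^ birkhoff_sum T f n (s i) <= cover_sum T f n e.
Proof.
move=> e01 fc sep; have /andP[e0 e1] := e01.
apply: cover_sum_ge => // k U [Ucov U0 Ue].
have hs (i : 'I_m) : exists j, U j (s i).
  by have : [set: X] (s i) by []; rewrite -Ucov => -[j _ Uj]; exists j.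
have [phi hphi] := choice hs.
have phi_inj : injective phi.
  move=> i j ij; apply: contra_eq (ij) => /sep sij; apply/eqP => phiij.
  have := hphi j; rewrite -phiij => Uj.
  have := bowen_dist_le_diam T Xc n (hphi i) Uj.
  by have := Ue (phi i); lra.
pose F j := e^-1 `^ sup (birkhoff_sum T f n @` U j).
apply: (@le_trans _ _ (\sum_(i < m) F (phi i))).
  apply: ler_sum => i _; apply: ler_powR; first by rewrite ltW// inv_gt1.
  exact: sup_birkhoff_ge.
rewrite -(big_imset F (in2W phi_inj))/=.
rewrite [leRHS](bigID (mem (phi @: 'I_m)%SET))/= lerDl.
by apply: sumr_ge0 => j _; exact: powR_ge0.
Qed.

(** The balls of radius e around the points of a spanning family have diameter at
    most 2 e < 3 e, and S_n f varies by at most n eta on each of them. *)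
Lemma cover_sum_le_spanning f n e eta m (s : 'I_m -> X) :
  0 < e -> 3 * e < 1 ->
  (forall x y, mdist x y < e -> f y <= f x + eta) ->
  (forall y, exists i, bowen_dist T n (s i) y < e) ->
  cover_sum T f n (3 * e) <=
    \sum_(i < m) (3 * e)^-1 `^ (birkhoff_sum T f n (s i) + n%:R * eta).
Proof.
move=> e0 e1 fe span.
have e30 : 0 < 3 * e by lra.
pose U (i : 'I_m) := [set y | bowen_dist T n (s i) y < e].
have U0 i : U i !=set0 by exists (s i); rewrite /U /= bowen_distxx.
apply: (le_trans (@cover_sum_le_fin _ _ T f n _ _ xpredT U _ _ _)) => //.
- by move=> x; have [i ix] := span x; exists i.
- move=> i _; apply: (@le_lt_trans _ _ (e + e)); last by lra.
  apply: bowen_diam_le => // y z /= yi zi.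
  rewrite (le_trans (bowen_dist_triangle T n y (s i) z))//.
  by rewrite lerD ?ltW// bowen_dist_sym.
apply: ler_sum => i _; apply: ler_powR; first by rewrite ltW// inv_gt1// e30.
apply: sup_birkhoff_le => // y; exact: birkhoff_sum_modulus.
Qed.

End separated_sets.

Section growth.
Context {R : realType} {X : pmetricType R} (T : X -> X).
Context (Xc : compact [set: X]) (Tc : continuous T).
Implicit Types (f g : X -> R) (n : nat) (e t : R).

(** The additive constant K disappears in the growth rate; it is what makes
    coboundaries invisible. *)
Lemma cover_growth_le f g e (c K : R) :
  0 < e < 1 -> continuous f -> continuous g ->
  (forall n x, birkhoff_sum T f n x <= birkhoff_sum T g n x + (n%:R * c + K)) ->
  cover_growth T f e <= cover_growth T g e + c * ln e^-1.
Proof.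
move=> e01 fc gc fg.
have := @limn_le_affine _ _ _ _ 1 0 (c * ln e^-1) (K * ln e^-1)
  (growth_is_cvg Xc Tc e01 fc) (growth_is_cvg Xc Tc e01 gc)
  (growth_is_cvg Xc Tc e01 gc).
rewrite mul1r mul0r addr0; apply => n n0.
have nR : (0 : R) < n%:R by rewrite ltr0n.
rewrite mul1r mul0r addr0 ler_pdivrMl//.
apply: (le_trans (ln_cover_sum_le Xc Tc e01 fc gc (fg n))).
rewrite le_eqVlt; apply/orP; left; apply/eqP; field.
by rewrite gt_eqF.
Qed.

Lemma cover_growth_ge f e (M : R) : 0 < e < 1 -> continuous f ->
  (forall x, `|f x| <= M) -> - M * ln e^-1 <= cover_growth T f e.
Proof.
move=> e01 fc fM; apply: limr_ge; first exact: growth_is_cvg.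
near=> n; have n0 : (0 < n)%N by near: n; exact: nbhs_infty_gt.
rewrite ler_pdivlMl ?ltr0n// mulNr mulrN.
exact: ln_cover_sum_lower_bound.
Unshelve. all: by end_near. Qed.

(** Convexity up to an error, between the scales e and 3 e. A single maximal
    e-separated set bounds the cover sums of f and g from below at scale e and
    that of h from above at scale 3 e, so Hoelder's inequality applies on it. The
    error M ln 3 comes from replacing (3 e)^-1 by e^-1 in the weights, the error
    eta ln (3 e)^-1 from the oscillation of h. *)
Lemma cover_growth_convex f g e t eta (M : R) :
  0 <= t <= 1 -> 0 < e -> 3 * e < 1 ->
  continuous f -> continuous g ->
  (forall x, `|f x| <= M) -> (forall x, `|g x| <= M) ->
  let h := fun x => t * f x + (1 - t) * g x in
  (forall x y, mdist x y < e -> h y <= h x + eta) ->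
  cover_growth T h (3 * e) <=
    t * cover_growth T f e + (1 - t) * cover_growth T g e +
    (M * ln 3 + eta * ln (3 * e)^-1).
Proof.
move=> t01 e0 e1 fc gc fM gM h he; have /andP[t0 t1] := t01.
have e01 : 0 < e < 1 by rewrite e0/=; lra.
have e301 : 0 < 3 * e < 1 by rewrite e1 andbT; lra.
have hc : continuous h.
  by move=> x; apply: cvgD; apply: cvgMr; [exact: fc|exact: gc].
have hM x : `|h x| <= M.
  rewrite /h (le_trans (ler_normD _ _))// !normrM (ger0_norm t0).
  rewrite (@ger0_norm _ (1 - t)) ?subr_ge0//.
  have := ler_wpM2l t0 (fM x); have := ler_wpM2l (_ : 0 <= 1 - t) (gM x).
  by rewrite subr_ge0 => /(_ t1); lra.
have ln3 : 0 <= ln (3 : R) by rewrite ln_ge0// ler1n.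
apply: (@limn_le_affine _ _ _ _ _ _ _ 0); try exact: growth_is_cvg.
move=> n n0; have nR : (0 : R) < n%:R by rewrite ltr0n.
rewrite mul0r addr0 ler_pdivrMl//.
set A := cover_sum T f n e; set B := cover_sum T g n e.
have A0 : 0 < A by exact: cover_sum_gt0.
have B0 : 0 < B by exact: cover_sum_gt0.
have -> : n%:R * (t * (n%:R^-1 * ln A) + (1 - t) * (n%:R^-1 * ln B) +
    (M * ln 3 + eta * ln (3 * e)^-1)) =
  n%:R * (M * ln 3 + eta * ln (3 * e)^-1) + (t * ln A + (1 - t) * ln B).
  by field; rewrite gt_eqF.
rewrite -[leRHS]expRK ler_ln ?posrE ?expR_gt0 ?cover_sum_gt0//.
have [m [s [sep span]]] := maximal_separated Xc Tc n e0.
apply: (le_trans (cover_sum_le_spanning e0 e1 he span)).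
have hA := separated_sum_le_cover_sum Xc Tc e01 fc sep.
have hB := separated_sum_le_cover_sum Xc Tc e01 gc sep.
have eqw (u : X -> R) : \sum_(i < m) e^-1 `^ birkhoff_sum T u n (s i) =
    \sum_(i < m) expR (birkhoff_sum T u n (s i) * ln e^-1).
  by apply: eq_bigr => i _; rewrite powR_inv_expR.
rewrite eqw in hA; rewrite eqw in hB.
rewrite expRD; have := hoelder_sum_expR t01 A0 B0 hA hB.
rewrite -(ler_pM2l (expR_gt0 (n%:R * (M * ln 3 + eta * ln (3 * e)^-1)))).
apply: le_trans; rewrite mulr_sumr; apply: ler_sum => i _.
rewrite powR_inv_expR; last by case/andP: e301.
rewrite -expRD ler_expR.
have -> : t * (birkhoff_sum T f n (s i) * ln e^-1) +
    (1 - t) * (birkhoff_sum T g n (s i) * ln e^-1) =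
    birkhoff_sum T h n (s i) * ln e^-1.
  by rewrite /h /birkhoff_sum big_split/= -!mulr_sumr; ring.
have := birkhoff_sum_bound T n (s i) hM; rewrite ler_norml => /andP[hb _].
have -> : ln e^-1 = ln (3 * e)^-1 + ln 3.
  rewrite !lnV ?posrE ?lnM ?posrE//; [by ring|by lra].
by nra.
Qed.

End growth.

(** * The upper metric mean dimension as a convex function *)

Section upper_mdim_functional.
Context {R : realType} {X : pmetricType R} (T : X -> X).
Context (Xc : compact [set: X]) (Tc : continuous T).
Implicit Types (f g : X -> R) (a c e t : R).

Lemma near_right0P (Q : R -> Prop) :
  (\forall e \near 0^'+, Q e) <-> exists2 d, 0 < d & forall e, 0 < e < d -> Q e.
Proof.
split=> [[d /= d0 hd]|[d d0 hd]].
  exists d => // e /andP[e0 ed]; apply: hd => //=.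
  by rewrite sub0r normrN gtr0_norm.
near=> e; apply: hd; apply/andP; split; near: e.
  exact: nbhs_right_gt.
exact: nbhs_right_lt.
Unshelve. all: by end_near. Qed.

Lemma ln_inv_gt0 e : 0 < e < 1 -> 0 < ln e^-1.
Proof. by move=> e01; rewrite ln_gt0// inv_gt1. Qed.

Lemma near_right0_lt1 : \forall e \near (0 : R)^'+, 0 < e < 1.
Proof. by apply/near_right0P; exists 1. Qed.

Lemma near_right0_ln_inv_ge (K : R) : \forall e \near 0^'+, K <= ln e^-1.
Proof.
apply/near_right0P; exists (expR (- K)); first exact: expR_gt0.
move=> e /andP[e0 eK]; rewrite lnV ?posrE// lerNr -[leRHS]expRK.
by rewrite ler_ln ?posrE ?expR_gt0// ltW.
Qed.

(** The upper limit is only ever bounded from above by real numbers; this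
    reformulation avoids computing with extended real suprema. *)
Lemma upper_mdim_leP f a : (upper_mdim T f <= a%:E)%E <->
  forall eta, 0 < eta -> \forall e \near 0^'+,
    cover_growth T f e <= (a + eta) * ln e^-1.
Proof.
split=> [fa eta eta0|h].
  have : (upper_mdim T f < (a + eta)%:E)%E.
    by rewrite (le_lt_trans fa)// lte_fin ltrDl.
  move=> /ereal_inf_lt[_ [A FA <-]] Aa.
  have := near_right0_lt1; apply: filterS2 FA => e Ae e01.
  rewrite -ler_pdivrMr ?ln_inv_gt0// -lee_fin (le_trans _ (ltW Aa))//.
  by apply: ereal_sup_ubound; exists e.
apply/lee_addgt0Pr => eta eta0; apply: ereal_inf_le.
exists (ereal_sup ((fun e => (cover_growth T f e / ln e^-1)%:E) @`
   [set e | 0 < e < 1 /\ cover_growth T f e <= (a + eta) * ln e^-1])).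
  eexists; last reflexivity.
  by have := h _ eta0; apply: filterS2 near_right0_lt1 => e.
apply: ge_ereal_sup => _ [e [e01 he] <-].
by rewrite -EFinD lee_fin ler_pdivrMr// ln_inv_gt0.
Qed.

Lemma upper_mdim_le_shift f g c K : continuous f -> continuous g ->
  (forall n x, birkhoff_sum T f n x <= birkhoff_sum T g n x + (n%:R * c + K)) ->
  forall a, (upper_mdim T g <= a%:E)%E -> (upper_mdim T f <= (a + c)%:E)%E.
Proof.
move=> fc gc fg a /upper_mdim_leP ga; apply/upper_mdim_leP => eta eta0.
have := ga _ eta0; apply: filterS2 near_right0_lt1 => e e01 ge.
rewrite (le_trans (cover_growth_le Xc Tc e01 fc gc fg))//.
by rewrite addrAC mulrDl lerD2r.
Qed.

(** With finiteness at the zero potential, this is what makes the upper metric mean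
    dimension a real number. *)
Lemma upper_mdim_lower_bound f M a : continuous f -> (forall x, `|f x| <= M) ->
  (upper_mdim T f <= a%:E)%E -> - M <= a.
Proof.
move=> fc fM /upper_mdim_leP fa; apply/ler_addgt0Pr => eta eta0.
near (0 : R)^'+ => e.
have e01 : 0 < e < 1 by near: e; exact: near_right0_lt1.
have fe : cover_growth T f e <= (a + eta) * ln e^-1 by near: e; exact: fa.
have := le_trans (cover_growth_ge Xc Tc e01 fc fM) fe.
by rewrite ler_pM2r// ln_inv_gt0.
Unshelve. all: by end_near. Qed.

Lemma upper_mdim_fin_num f : (upper_mdim T (fun=> 0%R) < +oo)%E ->
  continuous f -> upper_mdim T f \is a fin_num.
Proof.
move=> P0 fc; have [M M0 fM] := continuous_bounded Xc fc.
have [a fa] : exists a, (upper_mdim T f <= a%:E)%E.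
  have [b P0b] : exists b, (upper_mdim T (fun=> 0%R) <= b%:E)%E.
    move: P0; case: (upper_mdim T (fun=> 0%R)) => [b _|//|_].
      by exists b.
    by exists 0; rewrite leNye.
  exists (b + M); apply: upper_mdim_le_shift P0b => //.
    by move=> x; exact: cst_continuous.
  move=> n x; rewrite [X in _ <= X + _](_ : _ = 0).
    have := birkhoff_sum_bound T n x fM.
    by rewrite ler_norml add0r => /andP[_ h]; rewrite (le_trans h)// lerDl.
  by rewrite /birkhoff_sum big1.
move: fa; case E : (upper_mdim T f) => [r|//|] // _.
have := @upper_mdim_lower_bound f M (- M - 1) fc fM.
by rewrite E leNye => /(_ isT); lra.
Qed.

(** In [cover_growth_convex] the error is at most (constant) + d ln (1/e) with d
    arbitrarily small, and ln (3 e)^-1 differs from ln e^-1 by ln 3. So the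
    inequality becomes exact after division by ln (1/e), in the limit e -> 0. *)
Lemma upper_mdim_convex f g t a c : 0 <= t <= 1 ->
  continuous f -> continuous g ->
  (upper_mdim T f <= a%:E)%E -> (upper_mdim T g <= c%:E)%E ->
  (upper_mdim T (fun x => t * f x + (1 - t) * g x)%R
     <= (t * a + (1 - t) * c)%:E)%E.
Proof.
move=> t01 fc gc /upper_mdim_leP fa /upper_mdim_leP ga.
have /andP[t0 t1] := t01.
set h := fun x => _.
have hc : continuous h.
  by move=> x; apply: cvgD; apply: cvgMr; [exact: fc|exact: gc].
have [M1 M10 fM1] := continuous_bounded Xc fc.
have [M2 M20 gM2] := continuous_bounded Xc gc.
pose M := M1 + M2.
have fM x : `|f x| <= M by rewrite (le_trans (fM1 x))// lerDl.
have gM x : `|g x| <= M by rewrite (le_trans (gM2 x))// lerDr.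
apply/upper_mdim_leP => eta eta0.
(* the errors on f and g cost d together, the oscillation of h costs d, and the
   terms that stay bounded when the scale tends to 0 cost 2 d *)
pose d := eta / 4; have d0 : 0 < d by rewrite divr_gt0.
have /near_right0P[d1 d10 hd1] := fa _ d0.
have /near_right0P[d2 d20 hd2] := ga _ d0.
have /near_right0P[d3 d30 hd3] := compact_uniform_modulus Xc hc d0.
pose m := t * a + (1 - t) * c.
have /near_right0P[d4 d40 hd4] :=
  near_right0_ln_inv_ge ((m + d + M) * ln 3 / (2 * d)).
have min0 : 0 < Num.min (Num.min d1 d2) (Num.min d3 d4).
  by rewrite !lt_min d10 d20 d30.
apply/near_right0P; exists (Num.min (Num.min (Num.min d1 d2) (Num.min d3 d4)) 1).
  by rewrite lt_min min0 ltr01.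
move=> e' /andP[e'0]; rewrite !lt_min => /andP[/andP[/andP[e1 e2] /andP[e3 e4]] e5].
have [e ee'] : exists e, e' = 3 * e by exists (e' / 3); field.
have e0 : 0 < e by lra.
have lt_e : e < e' by lra.
have e31 : 3 * e < 1 by rewrite -ee'.
have := cover_growth_convex Xc Tc t01 e0 e31 fc gc fM gM
  (hd3 e (introT andP (conj e0 (lt_trans lt_e e3)))).
have hf := hd1 e (introT andP (conj e0 (lt_trans lt_e e1))).
have hg := hd2 e (introT andP (conj e0 (lt_trans lt_e e2))).
rewrite -ee' => /le_trans; apply.
have ln3e : ln e^-1 = ln e'^-1 + ln 3.
  rewrite ee' lnV ?posrE// [X in _ = X + _]lnV ?posrE ?lnM ?posrE ?mulr_gt0//.
  by ring.
have h4 : (m + d + M) * ln 3 <= ln e'^-1 * (2 * d).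
  by rewrite -ler_pdivrMr ?mulr_gt0//; apply: hd4; rewrite e'0.
have {}hf := ler_wpM2l t0 hf.
have t1' : 0 <= 1 - t by rewrite subr_ge0.
have {}hg := ler_wpM2l t1' hg.
rewrite ln3e in hf hg.
move: hf hg h4; rewrite /m /d.
move: (cover_growth T f e) (cover_growth T g e) (ln e'^-1) (ln 3) => u v l l3.
by move=> *; lra.
Qed.

End upper_mdim_functional.

(** * Representation of positive functionals by measures *)

Section urysohn.
Context {R : realType} {X : pmetricType R}.
Implicit Types (x y : X) (U : set X) (k : nat).

(** A substitute for the distance to the complement of U that also makes sense when
    U is the whole space: truncation at 1 keeps it finite. *)
Definition inner_radius U x : R :=
  sup [set r : R | 0 <= r <= 1 /\ ball x r `<=` U].

Let radii_ub U x : has_ubound [set r : R | 0 <= r <= 1 /\ ball x r `<=` U].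
Proof. by exists 1 => r [/andP[]]. Qed.

Let radii0 U x : [set r : R | 0 <= r <= 1 /\ ball x r `<=` U] 0.
Proof.
split; first by rewrite lexx ler01.
by move=> y; rewrite ballEmdist/= ltNge mdist_ge0.
Qed.

Lemma inner_radius_ge0 U x : 0 <= inner_radius U x.
Proof. by apply: ub_le_sup; [exact: radii_ub|exact: radii0]. Qed.

(** A ball of radius r around y contains the ball of radius r - d(x, y) around x. *)
Lemma inner_radius_lipschitz U x y :
  inner_radius U y <= inner_radius U x + mdist x y.
Proof.
apply: ge_sup; first by exists 0; exact: radii0.
move=> r [/andP[r0 r1] ryU].
have [rd|dr] := leP r (mdist x y).
  by rewrite (le_trans rd)// lerDr inner_radius_ge0.
rewrite -lerBlDr; apply: ub_le_sup; first exact: radii_ub.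
split; first by have := mdist_ge0 x y; lra.
move=> z; rewrite ballEmdist/= => xz; apply: ryU; rewrite ballEmdist/=.
by have := metric_triangle y x z; rewrite (metric_sym y x); lra.
Qed.

Lemma inner_radius_gt0 U x : open U -> U x -> 0 < inner_radius U x.
Proof.
move=> oU Ux.
have /nbhs_ballP[r /= r0 rU] : nbhs x U by exact: open_nbhs_nbhs.
apply: (@lt_le_trans _ _ (Num.min r 1)); first by rewrite lt_min r0 ltr01.
apply: ub_le_sup; first exact: radii_ub.
split; first by rewrite le_min ltW// ler01 ge_min lexx orbT.
move=> y; rewrite ballEmdist/= lt_min => /andP[xy _].
by apply: rU; rewrite ballEmdist.
Qed.

Lemma inner_radius_out U x : ~ U x -> inner_radius U x = 0.
Proof.
move=> nUx; apply/eqP; rewrite eq_le inner_radius_ge0 andbT.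
apply: ge_sup; first by exists 0; exact: radii0.
move=> r [_ rU]; rewrite leNgt; apply/negP => r0; apply: nUx; apply: rU.
exact: ballxx.
Qed.

(** For open U, these functions increase with k to the indicator function of U and
    each point of U is reached at a finite stage. *)
Definition open_plateau U k x : R := Num.min 1 (k%:R * inner_radius U x).

Lemma open_plateau0 U x : open_plateau U 0 x = 0.
Proof. by rewrite /open_plateau mul0r min_r. Qed.

Lemma open_plateau_le1 U k x : open_plateau U k x <= 1.
Proof. by rewrite ge_min lexx. Qed.

Lemma open_plateau_nondecreasing U k x :
  open_plateau U k x <= open_plateau U k.+1 x.
Proof.
rewrite le_min !ge_min lexx/=; apply/orP; right.
by rewrite ler_wpM2r ?inner_radius_ge0// ler_nat.
Qed.

Lemma open_plateau_continuous U k : continuous (open_plateau U k).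
Proof.
apply: (@lipschitz_continuous_mdist _ _ k%:R) => x y.
have h : k%:R * inner_radius U y <=
    k%:R * inner_radius U x + k%:R * mdist x y.
  by rewrite -mulrDr ler_wpM2l// inner_radius_lipschitz.
have d0 : 0 <= k%:R * mdist x y by rewrite mulr_ge0// mdist_ge0.
by rewrite /open_plateau addr_minl le_min !ge_min h lerDl d0 orbT.
Qed.

Lemma open_plateau_out U k x : ~ U x -> open_plateau U k x = 0.
Proof.
by move=> /inner_radius_out; rewrite /open_plateau => ->; rewrite mulr0 min_r.
Qed.

Lemma open_plateau_eventually1 U x : open U -> U x ->
  exists k, open_plateau U k x = 1.
Proof.
move=> oU Ux; have r0 := inner_radius_gt0 oU Ux.
exists (Num.bound (inner_radius U x)^-1).
rewrite /open_plateau min_l// -ler_pdivrMr// mul1r ltW//.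
by rewrite archi_boundP// invr_ge0 ltW.
Qed.

End urysohn.

Section daniell.
Context {R : realType} {X : pmetricType R} (Xc : compact [set: X]).
Context (L : (X -> R) -> R).
Context (L_lin : forall a (f g : X -> R), continuous f -> continuous g ->
  L (fun x => a * f x + g x) = a * L f + L g).
Context (L_ge0 : forall f : X -> R, continuous f -> (forall x, 0 <= f x) -> 0 <= L f).
Context (L_1 : L (fun=> 1) = 1).
Implicit Types (f g h : X -> R) (F : nat -> X -> R) (A U : set X).

Let cst_cont (c : R) : continuous (fun _ : X => c).
Proof. by move=> x; exact: cst_continuous. Qed.

Lemma functional0 : L (fun=> 0) = 0.
Proof.
rewrite -[RHS](addNr (L (fun=> 0))) -mulN1r -L_lin//; congr L.
by apply/funext => x; rewrite mulr0 addr0.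
Qed.

Lemma functionalD f g : continuous f -> continuous g ->
  L (fun x => f x + g x) = L f + L g.
Proof.
move=> fc gc; rewrite -[L f]mul1r -L_lin//; congr L.
by apply/funext => x; rewrite mul1r.
Qed.

Lemma functionalZ c f : continuous f -> L (fun x => c * f x) = c * L f.
Proof.
move=> fc; rewrite -[RHS]addr0 -functional0 -L_lin//.
by congr L; apply/funext => x; rewrite addr0.
Qed.

Lemma functionalB f g : continuous f -> continuous g ->
  L (fun x => f x - g x) = L f - L g.
Proof.
move=> fc gc; rewrite addrC -mulN1r -L_lin//; congr L.
by apply/funext => x; rewrite mulN1r addrC.
Qed.

Lemma functional_cst c : L (fun=> c) = c.
Proof.
rewrite -[RHS]mulr1 -L_1 -functionalZ//; congr L.
by apply/funext => x; rewrite mulr1.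
Qed.

Lemma functional_le f g : continuous f -> continuous g ->
  (forall x, f x <= g x) -> L f <= L g.
Proof.
move=> fc gc fg; rewrite -subr_ge0 -functionalB//; apply: L_ge0.
  by move=> x; apply: cvgB; [exact: gc|exact: fc].
by move=> x; rewrite subr_ge0.
Qed.

Lemma continuous_sum_seq F n : (forall i, continuous (F i)) ->
  continuous (fun x => \sum_(i < n) F i x).
Proof.
move=> Fc; elim: n => [|n IH].
  by under eq_fun do rewrite big_ord0; exact: cst_cont.
under eq_fun do rewrite big_ord_recr/=.
by move=> x; apply: cvgD; [exact: IH|exact: Fc].
Qed.

Lemma functional_sum F n : (forall i, continuous (F i)) ->
  L (fun x => \sum_(i < n) F i x) = \sum_(i < n) L (F i).
Proof.
move=> Fc; elim: n => [|n IH].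
  by rewrite big_ord0 -[RHS]functional0; congr L; apply/funext => x; rewrite big_ord0.
rewrite big_ord_recr/= -IH -functionalD//; last exact: continuous_sum_seq.
by congr L; apply/funext => x; rewrite big_ord_recr.
Qed.

Definition nneg_continuous F :=
  forall n, continuous (F n) /\ (forall x, 0 <= F n x).

Definition majorizing A : set (nat -> X -> R) :=
  [set F | nneg_continuous F /\
     forall x, A x -> (1 <= \sum_(n <oo) (F n x)%:E)%E].

(** The upper Daniell integral, for the functional L, of the indicator function of
    A. *)
Definition daniell_outer A : \bar R :=
  ereal_inf [set (\sum_(n <oo) (L (F n))%:E)%E | F in majorizing A].

Local Open Scope ereal_scope.

Lemma functional_nneg F n : nneg_continuous F -> 0 <= (L (F n))%:E.
Proof. by move=> FC; rewrite lee_fin L_ge0//; have [] := FC n. Qed.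

Lemma daniell_outer_ge0 A : 0 <= daniell_outer A.
Proof.
apply: le_ereal_inf_tmp => _ [F [FC _] <-].
by apply: nneseries_ge0 => n _ _; exact: functional_nneg.
Qed.

Lemma le_daniell_outer A B : A `<=` B -> daniell_outer A <= daniell_outer B.
Proof.
move=> AB; apply: ereal_inf_le_tmp => _ [F [FC FB] <-].
by exists F => //; split => // x /AB; exact: FB.
Qed.

Lemma daniell_outer_le_functional A g : continuous g -> (forall x, (0 <= g x)%R) ->
  (forall x, A x -> (1 <= g x)%R) -> daniell_outer A <= (L g)%:E.
Proof.
move=> gc g0 Ag; pose F n : X -> R := if n is 0%N then g else fun=> 0%R.
have sumF (G : (X -> R) -> R) : G (fun=> 0%R) = 0%R -> (0 <= G g)%R ->
    \sum_(n <oo) (G (F n))%:E = (G g)%:E.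
  move=> G0 Gg; rewrite nneseries_recl//; last first.
    by move=> [|n] _; rewrite lee_fin/= ?G0.
  by rewrite /= eseries0 ?adde0// => -[|n] //= _ _; rewrite G0.
apply: ereal_inf_lbound; exists F.
  split=> [[|n]|x Ax] //=.
  by rewrite (sumF (fun f => f x))// lee_fin Ag.
by rewrite (sumF L)//; [exact: functional0|exact: L_ge0].
Qed.

Lemma daniell_outer_le1 A : daniell_outer A <= 1.
Proof. by rewrite -L_1; apply: daniell_outer_le_functional. Qed.

Lemma daniell_outer_fin_num A : daniell_outer A \is a fin_num.
Proof.
rewrite ge0_fin_numE ?daniell_outer_ge0//.
by rewrite (le_lt_trans (daniell_outer_le1 A))// ltry.
Qed.

Lemma daniell_outer0 : daniell_outer set0 = 0.
Proof.
apply/eqP; rewrite eq_le daniell_outer_ge0 andbT.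
by have := @daniell_outer_le_functional set0 (fun=> 0%R); rewrite functional0; apply.
Qed.

(** A bijection between nat and nat * nat turns a double series of functions into
    a single one. *)
Lemma daniell_outer_double_series A (F : nat -> nat -> X -> R) :
  (forall n, nneg_continuous (F n)) ->
  (forall x, A x -> 1 <= \sum_(n <oo) \sum_(k <oo) (F n k x)%:E) ->
  daniell_outer A <= \sum_(n <oo) \sum_(k <oo) (L (F n k))%:E.
Proof.
move=> FC FA.
have : ([set: nat] #= [set: nat * nat])%card by rewrite card_eq_sym card_nat2.
move=> /card_set_bijP[phi phibij].
have reindex (a : nat -> nat -> R) : (forall n k, (0 <= a n k)%R) ->
    \sum_(n <oo) \sum_(k <oo) (a n k)%:E =
    \sum_(i <oo) (a (phi i).1 (phi i).2)%:E.
  move=> a0; rewrite [LHS]nneseries_esumT; last first.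
    by move=> n; apply: nneseries_ge0 => k _ _; rewrite lee_fin.
  rewrite [RHS]nneseries_esumT; last by move=> n; rewrite lee_fin.
  rewrite -(reindex_esum setT setT phi (fun p => (a p.1 p.2)%:E))//.
  rewrite -setXTT -(@esum_esum _ _ _ setT (fun=> setT) (fun n k => (a n k)%:E)).
    apply: eq_esum => n _; rewrite nneseries_esumT// => k.
    by rewrite lee_fin.
  by move=> n k _ _; rewrite lee_fin.
rewrite reindex; last by move=> n k; rewrite -lee_fin functional_nneg.
apply: ereal_inf_lbound; exists (fun i => F (phi i).1 (phi i).2) => //.
split=> [i|x Ax]; first exact: FC.
by rewrite -(reindex (fun n k => F n k x)) ?FA// => n k; exact: (FC n k).2.
Qed.

(** Put together majorizing sequences of the A n that are optimal up to
    e / 2^(n+1). *)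
Lemma daniell_outer_sigma_subadditive : sigma_subadditive daniell_outer.
Proof.
move=> A; apply/lee_addgt0Pr => e e0.
have hF n : exists F, majorizing (A n) F /\
    \sum_(k <oo) (L (F k))%:E <= daniell_outer (A n) + (e / (2 ^ n.+1)%:R)%:E.
  have en : (0 < e / (2 ^ n.+1)%:R)%R by rewrite divr_gt0// ltr0n expn_gt0.
  have : daniell_outer (A n) < daniell_outer (A n) + (e / (2 ^ n.+1)%:R)%:E.
    by rewrite lteDl ?daniell_outer_fin_num// lte_fin.
  by move=> /ereal_inf_lt[_ [F FA <-]] /ltW Fe; exists F.
have [F {}hF] := choice hF.
apply: (@le_trans _ _ (\sum_(n <oo) \sum_(k <oo) (L (F n k))%:E)).
  apply: daniell_outer_double_series => [n|x [n _ Anx]]; first exact: (hF n).1.1.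
  apply: le_trans ((hF n).1.2 x Anx) _.
  have F0 m : 0 <= \sum_(k <oo) (F m k x)%:E.
    by apply: nneseries_ge0 => k _ _; rewrite lee_fin; have [_] := (hF m).1.1 k.
  rewrite [leRHS](@nneseriesD1 _ _ n xpredT)//; apply: leeDl.
  by apply: nneseries_ge0.
apply: le_trans (epsilon_trick xpredT (fun n => daniell_outer_ge0 (A n)) (ltW e0)).
apply: lee_nneseries => n _; last exact: (hF n).2.
by move=> _; apply: nneseries_ge0 => k _ _; exact: functional_nneg (hF n).1.1.
Qed.

(** Dini's argument. If a series of nonnegative continuous functions is at least 1
    everywhere, then by compactness some partial sum is at least 1 - e everywhere,
    and positivity of L applies to this partial sum. *)
Lemma daniell_outer_setT : daniell_outer setT = 1.
Proof.
apply/eqP; rewrite eq_le daniell_outer_le1/=.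
apply: le_ereal_inf_tmp => _ [F [FC F1] <-].
apply/lee_addgt0Pr => e e0; rewrite -leeBlDr//.
have /compact_near_coveringP/(_ nat \oo
    (fun N x => (1 - e <= \sum_(i < N) F i x)%R) _) := Xc.
move=> H; have : \forall N \near \oo, [set: X] `<=`
    (fun x => (1 - e <= \sum_(i < N) F i x)%R).
  apply: H => x _.
  have : (1 - e)%:E < \sum_(n <oo) (F n x)%:E.
    by apply: lt_le_trans (F1 x I); rewrite lte_fin ltrBlDr ltrDl.
  have ndF : nondecreasing_seq (fun N => \sum_(0 <= n < N) (F n x)%:E).
    by apply: ereal_nondecreasing_series => n _; rewrite lee_fin; have [_] := FC n.
  have /cvg_lim -> // := ereal_nondecreasing_cvgn ndF.
  move=> /ereal_sup_gt[_ [N _ <-]].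
  rewrite sumEFin lte_fin big_mkord => eN.
  have sc := @continuous_sum_seq F N (fun i => (FC i).1).
  have : \forall x' \near x, (1 - e < \sum_(i < N) F i x')%R.
    exact: (cvgr_gt _ (sc x)).
  move=> eN'; exists ([set x' | (1 - e < \sum_(i < N) F i x')%R],
                      [set M | (N <= M)%N]).
    by split => //=; exact: nbhs_infty_ge.
  move=> [x' M] /= [ex' NM]; rewrite (le_trans (ltW ex'))//.
  rewrite -!(big_mkord xpredT (fun i => F i x')) (big_cat_nat _ NM)//=.
  by rewrite lerDl sumr_ge0// => i _; exact: (FC i).2.
move=> [N _ /(_ N (leqnn N)) HN].
apply: le_trans (nneseries_lim_ge N (fun n _ _ => functional_nneg n FC)).
rewrite sumEFin lee_fin big_mkord -functional_sum; last by move=> i; exact: (FC i).1.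
rewrite -[X in (X <= _)%R]functional_cst; apply: functional_le => //.
- exact: (@continuous_sum_seq F N (fun i => (FC i).1)).
- by move=> x; exact: HN.
Qed.

(** Let h k increase to the indicator of U and split a majorizing sequence F of A
    as F n = F n * h k + F n * (1 - h k). For each k the second part majorizes the
    points of A outside U. The first part majorizes those inside U only in the
    limit, which is why it is written as the double series of the increments
    F n * (h k.+1 - h k). *)
Lemma daniell_outer_open_caratheodory U A : open U ->
  daniell_outer (A `&` U) + daniell_outer (A `&` ~` U) <= daniell_outer A.
Proof.
move=> oU; apply: le_ereal_inf_tmp => _ [F [FC FA] <-].
pose h := open_plateau U.
pose G n k x := (F n x * (h k.+1 x - h k x))%R.
have Fc n := (FC n).1; have F0 n := (FC n).2.
have hc k : continuous (h k) by exact: open_plateau_continuous.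
have GC n : nneg_continuous (G n).
  move=> k; split=> x.
    by apply: cvgM; [exact: Fc|apply: cvgB; exact: hc].
  by rewrite mulr_ge0// subr_ge0 open_plateau_nondecreasing.
have tele n K x : (\sum_(0 <= k < K) G n k x = F n x * h K x)%R.
  by rewrite -mulr_sumr telescope_sumr// /h open_plateau0 subr0.
rewrite -leeBrDr ?daniell_outer_fin_num//.
apply: (@le_trans _ _ (\sum_(n <oo) \sum_(k <oo) (L (G n k))%:E)).
  apply: daniell_outer_double_series => // x [Ax Ux].
  apply: le_trans (FA x Ax) _; apply: lee_nneseries => n _.
    by move=> _; rewrite lee_fin.
  have [K hK] := open_plateau_eventually1 oU Ux.
  apply: (@le_trans _ _ (\sum_(0 <= k < K) (G n k x)%:E)).
    by rewrite sumEFin tele /h hK mulr1.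
  by apply: nneseries_lim_ge => k _ _; rewrite lee_fin; exact: (GC n k).2.
have LG0 n k : 0 <= (L (G n k))%:E by exact: functional_nneg.
rewrite nneseries_interchange//; apply: lime_le.
  by apply: is_cvg_nneseries => k _ _; apply: nneseries_ge0.
apply: nearW => K; rewrite -nneseries_sum_nat//.
rewrite leeBrDr ?daniell_outer_fin_num//.
have FhC n : continuous (fun x => F n x * h K x)%R.
  by move=> x; apply: cvgM; [exact: Fc|exact: hc].
have FhC' n : continuous (fun x => F n x * (1 - h K x))%R.
  move=> x; apply: cvgM; first exact: Fc.
  by apply: cvgB; [exact: cst_continuous|exact: hc].
have LGE n : \sum_(0 <= k < K) (L (G n k))%:E = (L (fun x => F n x * h K x)%R)%:E.
  rewrite sumEFin big_mkord -functional_sum; last by move=> k; exact: (GC n k).1.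
  by congr (L _)%:E; apply/funext => x; rewrite -tele big_mkord.
have h1 x : (0 <= 1 - h K x)%R by rewrite subr_ge0 open_plateau_le1.
apply: (@le_trans _ _ (\sum_(n <oo) (L (fun x => F n x * h K x)%R)%:E +
    \sum_(n <oo) (L (fun x => F n x * (1 - h K x))%R)%:E)).
  apply: leeD.
    by rewrite (eq_eseriesr (fun n _ => LGE n)).
  apply: ereal_inf_lbound; exists (fun n x => F n x * (1 - h K x))%R => //.
  split=> [n|x [Ax nUx]]; first by split => // x; rewrite mulr_ge0.
  rewrite (@eq_eseriesr _ _ (fun n => (F n x)%:E)) ?FA// => n _.
  by rewrite /h open_plateau_out// subr0 mulr1.
rewrite -nneseriesD; last 2 first.
- by move=> n _ _; rewrite -LGE sume_ge0.
- by move=> n _ _; rewrite lee_fin L_ge0// => x; rewrite mulr_ge0.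
rewrite le_eqVlt; apply/orP; left; apply/eqP/eq_eseriesr => n _.
rewrite -EFinD -functionalD//; congr (L _)%:E; apply/funext => x.
by rewrite -mulrDr addrC subrK mulr1.
Qed.

(** Caratheodory's theorem makes the outer measure a measure on a sigma-algebra
    that contains the open sets, hence the Borel sets. *)
Lemma daniell_measure : exists mu : probability (borel X) R,
  forall A : set (borel X), mu A = daniell_outer A.
Proof.
pose om : {outer_measure set X -> \bar R} := HB.pack daniell_outer
  (isOuterMeasure.Build R X daniell_outer daniell_outer0 daniell_outer_ge0
     le_daniell_outer daniell_outer_sigma_subadditive).
have sub : @measurable _ (borel X) `<=` @measurable _ (caratheodory_type om).
  apply: smallest_sub; first exact: sigma_algebra_measurable.
  move=> U oU; apply: le_caratheodory_measurable => A.
  exact: daniell_outer_open_caratheodory.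
have sadd : semi_sigma_additive (daniell_outer : set (borel X) -> \bar R).
  move=> A mA tA mUA; apply: (@caratheodory_measure_sigma_additive R X om A) => //.
    by move=> i; exact: sub.
  exact: sub.
pose im := isMeasure.Build _ (borel X) R daniell_outer daniell_outer0
  daniell_outer_ge0 sadd.
pose m : {measure set (borel X) -> \bar R} := HB.pack
  (daniell_outer : set (borel X) -> \bar R) im.
pose ip := Measure_isProbability.Build _ (borel X) R m daniell_outer_setT.
pose p : probability (borel X) R :=
  HB.pack (daniell_outer : set (borel X) -> \bar R) im ip.
by exists p.
Qed.

End daniell.

Section riesz.
Context {R : realType} {X : pmetricType R} (Xc : compact [set: X]).
Implicit Types (f g : X -> R).

Lemma open_borel (U : set X) : open U -> measurable (U : set (borel X)).
Proof. exact: sub_sigma_algebra. Qed.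

Lemma continuous_measurable_borel f : continuous f ->
  measurable_fun [set: borel X] (f : borel X -> R).
Proof.
move=> /continuousP fc; apply: (measurability _ (RGenOpens.measurableE R)).
move=> _ [_ [a [b ->] <-]]; rewrite setTI; apply: open_borel.
exact/fc/interval_open.
Qed.

Lemma continuous_integrable (mu : probability (borel X) R) f : continuous f ->
  mu.-integrable [set: borel X] (EFin \o f).
Proof.
move=> fc; have [M M0 fM] := continuous_bounded Xc fc.
apply: measurable_bounded_integrable => //.
- by rewrite (le_lt_trans (probability_le1 mu _))// ltry.
- exact: continuous_measurable_borel.
- exists M; split; first exact: num_real.
  by move=> y My x _ /=; rewrite (le_trans (fM x))// ltW.
Qed.

Context (L : (X -> R) -> R).
Context (L_lin : forall a (f g : X -> R), continuous f -> continuous g ->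
  L (fun x => a * f x + g x) = a * L f + L g).
Context (L_ge0 : forall f : X -> R, continuous f -> (forall x, 0 <= f x) -> 0 <= L f).
Context (L_1 : L (fun=> 1) = 1).

Let cst_cont (c : R) : continuous (fun _ : X => c).
Proof. by move=> x; exact: cst_continuous. Qed.

Context (mu : probability (borel X) R).
Context (muE : forall A : set (borel X), mu A = daniell_outer L A).

Lemma continuous_minr f c : continuous f -> continuous (fun x => Num.min (f x) c).
Proof.
move=> fc x; apply: (@continuous_min _ X f (fun=> c)); first exact: fc.
exact: cst_continuous.
Qed.

(** Cut f into N horizontal slices s i of height 1/N. The slice s i is at most 1/N
    times the indicator of B i = {f >= i/N}, so int f <= sum_i mu (B i) / N, while
    N s i is at least 1 on B (i+1), so mu (B (i+1)) <= N L (s i). The offset by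
    one slice costs at most 1/N. *)
Lemma integral_le_functional01 f : continuous f ->
  (forall x, 0 <= f x <= 1) -> (\int[mu]_x (f x)%:E <= (L f)%:E)%E.
Proof.
move=> fc f01.
apply/lee_addgt0Pr => e e0.
pose M := Num.bound e^-1; pose N : R := M.+1%:R.
have N0 : 0 < N by rewrite ltr0n.
have Ne : N^-1 <= e.
  rewrite invf_ple ?posrE// ltW// (lt_trans (archi_boundP _))//.
    by rewrite invr_ge0 ltW.
  by rewrite ltr_nat.
pose B (i : nat) : set (borel X) := [set x | i%:R / N <= f x].
have mB i : measurable (B i).
  rewrite -[B i]setCK; apply: measurableC; apply: open_borel.
  rewrite [X in open X](_ : _ = f @^-1` [set y | y < i%:R / N]).
    by move/continuousP : fc; apply; exact: open_lt.
  by apply/seteqP; split => x; rewrite /B/= ltNge => /negP.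
pose s (i : nat) x : R := Num.min (f x) (i.+1%:R / N) - Num.min (f x) (i%:R / N).
have sc i : continuous (s i).
  by move=> x; apply: cvgB; exact: continuous_minr.
have iN i : i%:R / N <= i.+1%:R / N by rewrite ler_pM2r ?invr_gt0// ler_nat.
have iN1 i : i.+1%:R / N = i%:R / N + N^-1 by rewrite -natr1 mulrDl mul1r.
have s0 i x : 0 <= s i x.
  by rewrite subr_ge0 le_min !ge_min lexx iN !orbT.
have ssum x : \sum_(0 <= i < M.+1) s i x = f x.
  rewrite telescope_sumr// divff ?gt_eqF// mul0r.
  by have /andP[f0 f1] := f01 x; rewrite min_l// min_r// subr0.
have muB i : (mu (B i.+1) <= (N * L (s i))%:E)%E.
  rewrite muE -(functionalZ L_lin _ (sc i)).
  apply: daniell_outer_le_functional => //.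
  - by move=> x; apply: cvgMr; exact: sc.
  - by move=> x; rewrite mulr_ge0// ltW.
  - move=> x; rewrite /B /s/= => Bx.
    rewrite min_r// min_r ?(le_trans (iN i))//.
    by rewrite iN1 addrAC subrr add0r divff// gt_eqF.
have sB i x : s i x <= N^-1 * \1_(B i) x.
  rewrite indicE; have [xB|xB] := boolP (x \in B i).
    have h : i%:R / N <= f x by rewrite inE in xB.
    by rewrite mulr1 /s (min_r h) lerBlDr addrC -iN1 ge_min lexx orbT.
  have h : f x < i%:R / N.
    by rewrite ltNge; apply: contra xB => h; rewrite inE.
  by rewrite mulr0 /s !min_l ?subrr// ltW// (lt_le_trans h).
apply: (@le_trans _ _
    (\int[mu]_x (\sum_(0 <= i < M.+1) (N^-1 * \1_(B i) x)%:E))%E).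
  apply: ge0_le_integral => //.
  - by move=> x _; rewrite lee_fin; have /andP[] := f01 x.
  - by apply/measurable_EFinP; exact: continuous_measurable_borel.
  - apply: emeasurable_sum => i; apply/measurable_EFinP.
    by apply: measurable_funM => //; exact: measurable_indic.
  - by move=> x _; rewrite sumEFin lee_fin -[leLHS]ssum; apply: ler_sum.
rewrite ge0_integral_sum//; last 2 first.
- move=> i; apply/measurable_EFinP.
  by apply: measurable_funM => //; exact: measurable_indic.
- by move=> i x _; rewrite lee_fin mulr_ge0// ?invr_ge0 ?ltW.
have intB i : (\int[mu]_x (N^-1 * \1_(B i) x)%:E = N^-1%:E * mu (B i))%E.
  under eq_integral do rewrite EFinM.
  rewrite ge0_integralZl_EFin//; last 2 first.
  - by apply/measurable_EFinP; exact: measurable_indic.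
  - by rewrite invr_ge0 ltW.
  by rewrite integral_indic// setIT.
under eq_bigr do rewrite intB.
rewrite big_nat_recl//= addeC; apply: leeD; last first.
  rewrite (@le_trans _ _ (N^-1%:E * 1)%E)//; last by rewrite mule1 lee_fin.
  by apply: lee_wpmul2l; [rewrite lee_fin invr_ge0 ltW|exact: probability_le1].
apply: (@le_trans _ _ (\sum_(0 <= i < M) (L (s i))%:E)%E).
  apply: lee_sum => i _.
  have := lee_wpmul2l (_ : 0 <= N^-1%:E)%E (muB i).
  rewrite -EFinM mulrA mulVf ?gt_eqF// mul1r; apply.
  by rewrite lee_fin invr_ge0 ltW.
rewrite sumEFin lee_fin big_mkord -(functional_sum L_lin)//.
apply: functional_le => //.
  exact: continuous_sum_seq.
move=> x; rewrite -[leRHS]ssum big_nat_recr//= big_mkord lerDl.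
exact: s0.
Qed.

(** One inequality suffices, applied to f and to - f. It is extended from [0, 1]
    to all values by an affine change of the function. *)
Lemma integral_functional f : continuous f ->
  (\int[mu]_x (f x)%:E)%E = (L f)%:E.
Proof.
have le g : continuous g -> (\int[mu]_x (g x)%:E <= (L g)%:E)%E.
  move=> gc; have [M M0 gM] := continuous_bounded Xc gc.
  (* g / c + 1/2 takes its values in [0, 1] *)
  pose c := (M + 1) *+ 2.
  have M1 : 0 < M + 1 by rewrite ltr_wpDl.
  have c0 : 0 < c by rewrite mulrn_wgt0.
  pose u x := c^-1 * g x + 2^-1.
  have uc : continuous u.
    move=> x; apply: cvgD; last exact: cst_continuous.
    by apply: cvgMr; exact: gc.
  have u01 x : 0 <= u x <= 1.
    have := gM x; rewrite ler_norml => /andP[g1 g2].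
    have h1 : c^-1 * g x <= 2^-1 by rewrite ler_pdivrMl// /c; lra.
    have h2 : - 2^-1 <= c^-1 * g x by rewrite ler_pdivlMl// /c; lra.
    by rewrite /u; lra.
  have := integral_le_functional01 uc u01.
  rewrite /u (L_lin c^-1 gc (@cst_cont _)) (functional_cst L_lin L_1).
  under eq_integral do rewrite EFinD EFinM.
  rewrite integralD//=; last 2 first.
  - by apply: integrableZl => //; exact: continuous_integrable.
  - by apply: (continuous_integrable mu (@cst_cont 2^-1)).
  rewrite integralZl//; last exact: continuous_integrable.
  have -> : (\int[mu]_x (2^-1)%:E = (2^-1)%:E)%E.
    by rewrite integral_cst// [X in (_ * X)%E](_ : _ = 1%E) ?mule1//; exact: probability_setT.
  rewrite EFinD leeD2rE// EFinM lee_pmul2l// lte_fin invr_gt0//.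
move=> fc; apply/eqP; rewrite eq_le le//=.
have fNc : continuous (fun x => - f x).
  by move=> x; apply: cvgN; exact: fc.
have := le _ fNc.
have -> : L (fun x => - f x) = - L f.
  have := functionalZ L_lin (-1) fc; rewrite mulN1r => <-.
  by congr L; apply/funext => x; rewrite mulN1r.
under eq_integral do rewrite EFinN.
rewrite integralN; last first.
  by apply: integrable_add_def => //; exact: continuous_integrable.
by rewrite EFinN leeN2.
Qed.

(** Composition with T sends majorizing sequences of A to majorizing sequences of
    the preimage of A, with the same values of L. So mu (T^-1 A) <= mu A for every
    Borel set A, and equality follows by passing to the complement. *)
Lemma functional_invariant_measure (T : X -> X) : continuous T ->
  (forall f, continuous f -> L (f \o T) = L f) ->
  invariant_probabilities T mu.
Proof.
move=> Tc LT.
have le A : (daniell_outer L (T @^-1` A) <= daniell_outer L A)%E.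
  apply: le_ereal_inf_tmp => _ [F [FC FA] <-].
  apply: ereal_inf_lbound; exists (fun n => F n \o T).
    split=> [n|x TAx]; last exact: FA.
    split=> x; last exact: (FC n).2.
    by apply: continuous_comp; [exact: Tc|exact: (FC n).1].
  by apply: eq_eseriesr => n _; rewrite LT//; exact: (FC n).1.
move=> A mA; rewrite /pushforward.
apply/eqP; rewrite eq_le !muE le/=.
have mT : measurable_fun [set: borel X] (T : borel X -> borel X).
  apply: (measurability _ (erefl (@measurable _ (borel X)))) => _ [U oU <-].
  by rewrite setTI; apply: open_borel; move/continuousP : Tc; exact.
have mTA : measurable (T @^-1` A : set (borel X)).
  by rewrite -[X in measurable X]setTI; exact: mT.
have := le (~` A); rewrite preimage_setC -!muE.
rewrite !probability_setC//.
rewrite leeBlDr ?fin_num_measure// addeAC leeBrDr ?fin_num_measure//.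
by rewrite leeD2lE.
Qed.

End riesz.

(** * Subgradients and the variational principle *)

Section subgradient.
Context {R : realType} {X : pmetricType R} (T : X -> X).
Context (Xc : compact [set: X]) (Tc : continuous T).
Context (P0 : (upper_mdim T (fun=> 0%R) < +oo)%E).
Implicit Types (f g h : X -> R).

Definition fin_upper_mdim f : R := fine (upper_mdim T f).

Lemma fin_upper_mdimE f : continuous f ->
  upper_mdim T f = (fin_upper_mdim f)%:E.
Proof. by move=> fc; rewrite fineK//; exact: upper_mdim_fin_num. Qed.

Lemma fin_upper_mdim_le_shift f g c K : continuous f -> continuous g ->
  (forall n x, birkhoff_sum T f n x <= birkhoff_sum T g n x + (n%:R * c + K)) ->
  fin_upper_mdim f <= fin_upper_mdim g + c.
Proof.
move=> fc gc fg; rewrite -lee_fin -fin_upper_mdimE//.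
by apply: (upper_mdim_le_shift Xc Tc fc gc fg); rewrite fin_upper_mdimE.
Qed.

Lemma fin_upper_mdim_le f g c : continuous f -> continuous g ->
  (forall x, f x <= g x + c) -> fin_upper_mdim f <= fin_upper_mdim g + c.
Proof.
move=> fc gc fg; apply: (@fin_upper_mdim_le_shift _ _ _ 0) => // n x.
have -> : n%:R * c + 0 = \sum_(j < n) c.
  by rewrite addr0 sumr_const card_ord mulr_natl.
by rewrite -big_split/=; apply: ler_sum.
Qed.

(** Birkhoff sums of a coboundary telescope, hence are bounded in n. *)
Lemma fin_upper_mdim_coboundary g h : continuous g -> continuous h ->
  fin_upper_mdim (fun x => g x + (h (T x) - h x)) <= fin_upper_mdim g.
Proof.
move=> gc hc; have [M M0 hM] := continuous_bounded Xc hc.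
rewrite -[leRHS]addr0; apply: (@fin_upper_mdim_le_shift _ _ _ (M + M)) => //.
  move=> x; apply: cvgD; first exact: gc.
  apply: cvgB; last exact: hc.
  by apply: continuous_comp; [exact: Tc|exact: hc].
move=> n x; rewrite mulr0 add0r /birkhoff_sum big_split/= lerD2l.
rewrite -(big_mkord xpredT (fun j => h (iter j.+1 T x) - h (iter j T x))).
rewrite telescope_sumr//.
have := hM (iter n T x); have := hM x; rewrite !ler_norml /=; lra.
Qed.

Lemma fin_upper_mdim_convex f g t : 0 <= t <= 1 -> continuous f -> continuous g ->
  fin_upper_mdim (fun x => t * f x + (1 - t) * g x) <=
  t * fin_upper_mdim f + (1 - t) * fin_upper_mdim g.
Proof.
move=> t01 fc gc; rewrite -lee_fin -fin_upper_mdimE; last first.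
  by move=> x; apply: cvgD; apply: cvgMr; [exact: fc|exact: gc].
by apply: (upper_mdim_convex Xc Tc t01 fc gc); rewrite fin_upper_mdimE.
Qed.

(** This is the test function in the infimum defining F(mu) that gives
    F(mu) + int f dmu <= P(f). *)
Lemma zero_mdim_potential_normalize f : continuous f ->
  zero_mdim_potentials T (fun x => fin_upper_mdim f - f x).
Proof.
move=> fc; set c := fin_upper_mdim f.
have gc : continuous (fun x => c - f x).
  by move=> x; apply: cvgB; [exact: cst_continuous|exact: fc].
have gNc : continuous (\- (fun x => c - f x)).
  by move=> x; apply: cvgN; exact: gc.
split => //; rewrite fin_upper_mdimE//; congr (_%:E).
apply/eqP; rewrite eq_le; apply/andP; split.
  rewrite -(subrr c); apply: fin_upper_mdim_le => // x /=.
  by rewrite opprB.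
rewrite -(subrr c) lerBlDr; apply: fin_upper_mdim_le => // x /=.
by rewrite opprB subrK.
Qed.

(** Hahn-Banach for the convex function h |-> P(f + h) - P(f), which vanishes at
    0. *)
Lemma subgradient_exists f : continuous f -> exists L : (X -> R) -> R,
  (forall a g h, continuous g -> continuous h ->
     L (fun x => a * g x + h x) = a * L g + L h) /\
  (forall h, continuous h ->
     L h <= fin_upper_mdim (fun x => f x + h x) - fin_upper_mdim f).
Proof.
move=> fc.
pose q (h : X -> R^o) := fin_upper_mdim (fun x => f x + h x) - fin_upper_mdim f.
have fhc (h : X -> R) : continuous h -> continuous (fun x => f x + h x).
  by move=> hc x; apply: cvgD; [exact: fc|exact: hc].
have := @hahn_banach_convex R (X -> R^o) [set h | continuous (h : X -> R)] q.
case=> [||||L [Llin Lq]].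
- by move=> x; exact: cst_continuous.
- by move=> a u v uc vc x; apply: cvgD; [apply: cvgMr; exact: uc|exact: vc].
- rewrite /q (_ : (fun x => f x + _) = f) ?subrr//.
  by apply/funext => x; rewrite addr0.
- move=> t u v t01 uc vc; rewrite /q.
  rewrite (_ : (fun x => f x + _) =
      (fun x => t * (f x + u x) + (1 - t) * (f x + v x))); last first.
    apply/funext => x.
    by transitivity (f x + (t * u x + (1 - t) * v x)) => //; ring.
  have := fin_upper_mdim_convex t01 (fhc _ uc) (fhc _ vc).
  set pf := fin_upper_mdim f; set pu := fin_upper_mdim (fun x => f x + u x).
  set pv := fin_upper_mdim (fun x => f x + v x); set ptuv := fin_upper_mdim _.
  by move: pf pu pv ptuv => pf pu pv ptuv; lra.
by exists L; split => // a g h gc hc; exact: (Llin a g h gc hc).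
Qed.

End subgradient.

Theorem theorem1p1 (R : realType) (X : pmetricType R) (T : X -> X) :
  compact [set: X] ->
  continuous T ->
  (upper_mdim T (fun=> 0%R) < +oo)%E ->
  forall f : X -> R, continuous f ->
  is_maximum
    [set (measure_upper_mdim T mu + \int[mu]_x (f x)%:E)%E
      | mu in invariant_probabilities T]
    (upper_mdim T f).
Proof.
move=> Xc Tc P0 f fc.
pose p := fin_upper_mdim T.
have pE (g : X -> R) : continuous g -> upper_mdim T g = (p g)%:E by exact: fin_upper_mdimE.
have ub (mu : probability (borel X) R) :
    (measure_upper_mdim T mu + \int[mu]_x (f x)%:E <= upper_mdim T f)%E.
  have fint := continuous_integrable Xc mu fc.
  rewrite -leeBrDr; last exact: integrable_fin_num.
  apply: ereal_inf_lbound; exists (fun x => p f - f x).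
    exact: zero_mdim_potential_normalize.
  under eq_integral do rewrite EFinB.
  rewrite integralB//; last first.
    by apply: (continuous_integrable Xc mu (f := fun=> p f)) => x; exact: cst_continuous.
  rewrite integral_cst// [X in (_ * X)%E](_ : _ = 1%E) ?mule1 ?pE//.
  exact: probability_setT.
split; last by move=> _ [mu _ <-]; exact: ub.
have [L [Llin Lsub]] := subgradient_exists Xc Tc P0 fc.
have cc (c : R) : continuous (fun _ : X => c) by move=> x; exact: cst_continuous.
have fhc (h : X -> R) : continuous h -> continuous (fun x => f x + h x).
  by move=> hc x; apply: cvgD; [exact: fc|exact: hc].
have LN (h : X -> R) : continuous h -> L (fun x => - h x) = - L h.
  move=> hc; have := functionalZ Llin (-1) hc; rewrite mulN1r => <-.
  by congr L; apply/funext => x; rewrite mulN1r.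
have Nc (h : X -> R) : continuous h -> continuous (fun x => - h x).
  by move=> hc x; apply: cvgN; exact: hc.
have Lle (h : X -> R) (c : R) : continuous h -> (forall x, h x <= c) -> L h <= c.
  move=> hc h0; rewrite (le_trans (Lsub _ hc))// lerBlDl.
  by apply: fin_upper_mdim_le => //; [exact: fhc|move=> x; rewrite lerD2l].
have L_ge0 (h : X -> R) : continuous h -> (forall x, 0 <= h x) -> 0 <= L h.
  move=> hc h0; rewrite -oppr_le0 -LN//; apply: Lle; first exact: Nc.
  by move=> x; rewrite oppr_le0.
have L_1 : L (fun=> 1) = 1.
  apply/eqP; rewrite eq_le Lle//= -lerN2 -LN//.
  by apply: Lle => //; exact: Nc.
have LT (h : X -> R) : continuous h -> L (h \o T) = L h.
  have le (g : X -> R) : continuous g -> L (g \o T) <= L g.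
    move=> gc; have gTc : continuous (g \o T).
      by move=> x; apply: continuous_comp; [exact: Tc|exact: gc].
    rewrite -subr_le0 -(functionalB Llin)//.
    apply: le_trans (Lsub _ _) _.
      by move=> x; apply: cvgB; [exact: gTc|exact: gc].
    by rewrite subr_le0; exact: fin_upper_mdim_coboundary.
  move=> hc; apply/eqP; rewrite eq_le le//= -lerN2 -!LN//.
    exact: le (Nc _ hc).
  by move=> x; apply: continuous_comp; [exact: Tc|exact: hc].
have [mu muE] := daniell_measure Xc Llin L_ge0 L_1.
have muL := integral_functional Xc Llin L_ge0 L_1 muE.
exists mu; first exact: (functional_invariant_measure muE Tc LT).
apply/eqP; rewrite eq_le ub/= muL// pE//.
rewrite -leeBlDr//; apply: le_ereal_inf_tmp => _ [g [gc g0] <-].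
rewrite muL// -EFinB lee_fin lerBlDr.
have gfc : continuous (fun x => - g x - f x).
  by move=> x; apply: cvgB; [exact: Nc|exact: fc].
have := Lsub _ gfc; rewrite (functionalB Llin (Nc _ gc) fc) LN//.
rewrite (_ : (fun x => f x + _) = \- g); last first.
  by apply/funext => x /=; rewrite addrC subrK.
have -> : fin_upper_mdim T (\- g) = 0 by rewrite /fin_upper_mdim g0.
rewrite /p; move: (fin_upper_mdim T f) (L f) (L g) => pf Lf Lg.
by lra.
Qed.
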